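(* Assume that $1 \leq p \leq q \leq \infty$. Let $T: C^p(X,E)\to C^q(Y,F)$ be a compact, separating, nowhere trivial linear operator with support map $h$. Then there exist $\ell\in \mathbb{N}_p$, functions $\Phi_k: Y\times \mathcal{S}^k(G,E) \to F$, $0 \leq k \leq \ell$, a relatively compact set $(x_\alpha)$ in $X$ and a partition $(Y_\alpha)$ of $Y$ into clopen subsets of $Y$ so that $$Tf(y) = \sum^{\ell}_{k=0}\Phi_k(y, D^kf(x_\alpha))$$ for all $f\in C^p(X,E)$, all $\alpha$ and all $y \in Y_\alpha$. For a given $y$, $\Phi_k(y,\cdot)$ is a bounded linear operator from $\mathcal{S}^k(G,E)$ into $F$. For each $S \in \mathcal{S}^k(G,E)$, $\Phi_k(y,S)$ belongs to $C^q(Y,F)$ as a function of $y$. Moreover, for any $k \leq \ell$, (a) for any $y \in Y$ and $m \in \mathbb{N}_q$, the map $D_y^m\Phi_k(y,\cdot): \mathcal{S}^k(G,E) \to \mathcal{S}^m(H,F)$ is a compact operator; (b) for each $m \in \mathbb{N}_q$, the map $y\mapsto D_y^m\Phi_k(y,\cdot)$ from $Y$ into the space of bounded linear operators $L(\mathcal{S}^k(G,E), \mathcal{S}^m(H,F))$ is continuous with respect to the operator norm topology. Conversely, any operator $T$ on $C^p(X,E)$ for which there exist $\ell\in\mathbb{N}_p$, functions $\Phi_k: Y\times \mathcal{S}^k(G,E) \to F$, $0\le k\le \ell$, a relatively compact set $(x_\alpha)$ in $X$ and a partition $(Y_\alpha)$ of $Y$ into clopen subsets of $Y$ such that $Tf(y)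 = \sum^{\ell}_{k=0}\Phi_k(y, D^kf(x_\alpha))$ for all $f\in C^p(X,E)$, all $\alpha$ and all $y \in Y_\alpha$, and such that for every $0\le k\le\ell$: $\Phi_k(y,\cdot)$ is a bounded linear operator from $\mathcal{S}^k(G,E)$ into $F$ for each $y\in Y$; $\Phi_k(\cdot,S)$ belongs to $C^q(Y,F)$ for each $S\in\mathcal{S}^k(G,E)$; $D_y^m\Phi_k(y,\cdot): \mathcal{S}^k(G,E) \to \mathcal{S}^m(H,F)$ is a compact operator for all $y\in Y$ and $m\in\mathbb{N}_q$; and $y\mapsto D_y^m\Phi_k(y,\cdot)$ is continuous from $Y$ into $L(\mathcal{S}^k(G,E), \mathcal{S}^m(H,F))$ with respect to the operator norm topology for each $m\in\mathbb{N}_q$, is a compact, separating linear operator from $C^p(X,E)$ into $C^q(Y,F)$.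
   Context: $G,H,E,F$ are real Banach spaces; $X\subseteq G$ and $Y\subseteq H$ are open. $\mathbb{N}_p=\{i\in\mathbb{N}\cup\{0\}: i\le p\}$ (all nonnegative integers if $p=\infty$). $\mathcal{S}^k(G,E)$ is the Banach space of bounded symmetric $k$-linear maps $G^k\to E$, with $\mathcal{S}^0(G,E)=E$. $C^p(X,E)$ is the space of all $f:X\to E$ such that for all $k\in\mathbb{N}_p$ the Fréchet derivative $D^kf$ ($D^0f=f$) is a continuous function from $X$ to $\mathcal{S}^k(G,E)$; $C^p(X)=C^p(X,\mathbb{R})$. $C^p(X,E)$ carries the topology generated by the seminorms $\rho_{K,k}(f)=\sup_{x\in K}\sup_{0\le j\le k}\|D^jf(x)\|$, $K\subseteq X$ compact, $k\in\mathbb{N}_p$; similarly for $C^q(Y,F)$. $D_y^m\Phi_k(y,\cdot)$ denotes the map sending $S$ to the $m$-th derivative, at $y$, of the function $y\mapsto\Phi_k(y,S)$. The points $x_\alpha$ and sets $Y_\alpha$ are indexed by the same index set. Standing assumption: there is a bump function $\varphi\in C^p(G)=C^p(G,\mathbb{R})$ with $\varphi(x)=1$ if $\|x\|\le 1/2$, $\varphi(x)=0$ if $\|x\|\ge1$, and $\sup_{x\in G}\|D^k\varphi(x)\|<\infty$ for all $k\in\mathbb{N}_p$. A linear map between topological vector spaces is compact if it maps some (nonempty) open set onto a relatively compact set. Two functions are disjoint if at every point at least one of them is $0$. A map $T$ is separating if it maps disjoint functions to disjoint functions. $T$ is nowhere trivial if for every $y\in Y$ there is $f\in C^p(X,E)$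 with $Tf(y)\ne0$. Support map: let $\mathbb{R}_\infty$ be the one-point compactification of $\mathbb{R}$, $i:X\to\mathbb{R}_\infty^{C^p(X)}$, $i(x)(\psi)=\psi(x)$ (a homeomorphic embedding), and let $\mathcal{A}X$ be the closure of $i(X)$. For $f\in C^p(X,E)$ let $\overline{C}(f)$ be the closure in $\mathcal{A}X$ of $i(\{x:f(x)\ne0\})$. For $y\in Y$ let $\mathcal{O}_y$ be the family of open subsets $U$ of $\mathcal{A}X$ for which there is $f\in C^p(X,E)$ with $Tf(y)\ne0$ and $\overline{C}(f)\subseteq U$. Then $h(y)$ is the unique point of $\bigcap\{\overline{U}^{\mathcal{A}X}:U\in\mathcal{O}_y\}$; for $T$ continuous, separating and nowhere trivial, $h(y)\in i(X)$, and $i(X)$ is identified with $X$, so that $h:Y\to X$. *)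

(* Defs.v *)
From HB Require Import structures.
From mathcomp Require Import all_boot all_order all_algebra all_fingroup.
From mathcomp Require Import all_classical all_reals all_analysis.

Set Implicit Arguments.
Unset Strict Implicit.
Unset Printing Implicit Defensive.

Import Order.TTheory GRing.Theory Num.Theory.
Import numFieldNormedType.Exports.

Local Open Scope classical_set_scope.
Local Open Scope ring_scope.

(* Orders of smoothness are elements of nat + {oo}, with None standing for oo. *)
Definition smooth_order := option nat.

Definition le_order (p q : smooth_order) : bool :=
  match p, q with
  | _, None => true
  | None, Some _ => false
  | Some m, Some n => (m <= n)%N
  end.

Definition in_N (p : smooth_order) (k : nat) : bool := le_order (Some k) p.

Lemma in_NS p k : in_N p k.+1 -> in_N p k.
Proof. by case: p => //= n; rewrite /in_N /= => /ltnW. Qed.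

Section SymmetricMultilinear.
Context {R : realType} (k : nat) (G E : normedModType R).
Implicit Types (S : ('I_k -> G) -> E).

(* dfwith v i u is the family v with its i-th entry replaced by u *)
Definition multilinear S := forall (v : 'I_k -> G) (i : 'I_k) (a : R) (u w : G),
  S (@dfwith _ (fun=> G) v i (a *: u + w)) =
  a *: S (@dfwith _ (fun=> G) v i u) + S (@dfwith _ (fun=> G) v i w).

Definition symmetric_map S := forall (s : 'S_k) (v : 'I_k -> G),
  S (v \o s) = S v.

Definition bounded_map S :=
  exists M : R, forall v : 'I_k -> G, `|S v| <= M * \prod_(i < k) `|v i|.

Definition symmultilin : {pred ('I_k -> G) -> E} :=
  [pred S | `[< [/\ multilinear S, symmetric_map S & bounded_map S] >]].

Lemma symmultilinP S : S \in symmultilin <->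
  [/\ multilinear S, symmetric_map S & bounded_map S].
Proof. by rewrite unfold_in; split => /asboolP. Qed.

Record Sym := MkSym {
  Sym_fun :> ('I_k -> G) -> E;
  Sym_funP : Sym_fun \in symmultilin
}.

HB.instance Definition _ := [isSub for Sym_fun].
HB.instance Definition _ := [Choice of Sym by <:].

Lemma symmultilin_submod : submod_closed symmultilin.
Proof.
split.
  apply/symmultilinP; split=> [v i a u w|s v|] //.
    by rewrite /= scaler0 addr0.
  by exists 0 => v; rewrite mul0r normr0.
move=> c S T /symmultilinP[mS sS [M bS]] /symmultilinP[mT sT [N bT]].
apply/symmultilinP; split=> [v i a u w|s v|].
- rewrite !fctE mS mT !scalerDr !scalerA -!addrA; congr (_ + _).
    by rewrite mulrC.
  by rewrite addrCA.
- by rewrite !fctE sS sT.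
- exists (`|c| * M + N) => v; rewrite !fctE mulrDl.
  rewrite (le_trans (ler_normD _ _))// lerD// normrZ -mulrA ler_wpM2l//.
Qed.

HB.instance Definition _ :=
  GRing.isSubmodClosed.Build R _ symmultilin symmultilin_submod.
HB.instance Definition _ := [SubChoice_isSubLmodule of Sym by <:].

Definition Sym_norm (S : Sym) : R :=
  sup [set `|S v| | v in [set v : 'I_k -> G | forall i, `|v i| <= 1]].

Lemma SymP (S : Sym) : [/\ multilinear S, symmetric_map S & bounded_map S].
Proof. by case: S => S /= /symmultilinP. Qed.

Lemma SymE (a : R) (S T : Sym) v : (a *: S + T) v = a *: S v + T v.
Proof. by []. Qed.

Lemma Sym_inj (S T : Sym) : (forall v, S v = T v) -> S = T.
Proof. by move=> h; apply: val_inj; apply/funext => v; exact: h. Qed.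

Lemma Sym_norm_has_sup (S : Sym) :
  has_sup [set `|S v| | v in [set v : 'I_k -> G | forall i, `|v i| <= 1]].
Proof.
split; first by exists `|S (fun=> 0)|, (fun=> 0) => // i; rewrite normr0.
have [_ _ [M bS]] := SymP S.
exists `|M| => _ [v v1 <-]; apply: (le_trans (bS v)).
apply: (@le_trans _ _ (`|M| * \prod_(i < k) `|v i|)).
  by rewrite ler_wpM2r ?prodr_ge0// ler_norm.
by rewrite ler_piMr//; apply: prodr_ile1 => i _; rewrite normr_ge0 v1.
Qed.

Lemma Sym_norm_ge (S : Sym) v : (forall i, `|v i| <= 1) -> `|S v| <= Sym_norm S.
Proof.
by move=> v1; apply: sup_upper_bound; [exact: Sym_norm_has_sup|exists v].
Qed.

Lemma Sym_norm_le (S : Sym) M :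
  (forall v, (forall i, `|v i| <= 1) -> `|S v| <= M) -> Sym_norm S <= M.
Proof.
move=> h; apply: ge_sup; first by have [] := Sym_norm_has_sup S.
by move=> _ [v v1 <-]; exact: h.
Qed.

Lemma Sym_scale (S : Sym) (c : 'I_k -> R) (v : 'I_k -> G) :
  S (fun i => c i *: v i) = (\prod_(i < k) c i) *: S v.
Proof.
have [mS _ _] := SymP S.
have mZ w i a u : S (@dfwith _ (fun=> G) w i (a *: u)) =
                  a *: S (@dfwith _ (fun=> G) w i u).
  have S0 : S (@dfwith _ (fun=> G) w i 0) = 0.
    have := mS w i (-1) 0 0.
    by rewrite scaler0 add0r scaleN1r addNr.
  by rewrite -[a *: u]addr0 mS S0 addr0.
suff H (s : seq 'I_k) : uniq s ->
    S (fun i => if i \in s then c i *: v i else v i) =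
    (\prod_(i <- s) c i) *: S v.
  have := H (index_enum 'I_k) (index_enum_uniq _).
  rewrite (_ : (fun i => if _ then _ else _) = (fun i => c i *: v i))//.
  by apply/funext => i; rewrite mem_index_enum.
elim: s => [_|j s IH /= /andP[js us]].
  by rewrite big_nil scale1r.
rewrite big_cons -scalerA -(IH us).
set w := fun i => if i \in s then _ else _.
have -> : w = @dfwith _ (fun=> G) w j (v j).
  apply/funext => i; case: (eqVneq j i) => [<-|ji]; last by rewrite dfwithout.
  by rewrite dfwithin /w (negbTE js).
rewrite -mZ; congr (Sym_fun S _); apply/funext => i; rewrite in_cons.
case: (eqVneq j i) => [<-|ji]; first by rewrite dfwithin.
by rewrite dfwithout.
Qed.

Fact Sym_ler_normD (S T : Sym) : Sym_norm (S + T) <= Sym_norm S + Sym_norm T.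
Proof.
apply: Sym_norm_le => v v1; apply: (le_trans (ler_normD _ _)).
by rewrite lerD// Sym_norm_ge.
Qed.

Fact Sym_normrZ (a : R) (S : Sym) : Sym_norm (a *: S) = `|a| * Sym_norm S.
Proof.
have le b T : Sym_norm (b *: T) <= `|b| * Sym_norm T.
  by apply: Sym_norm_le => v v1; rewrite normrZ ler_wpM2l// Sym_norm_ge.
apply/eqP; rewrite eq_le le /=.
have [->|a0] := eqVneq a 0.
  rewrite normr0 mul0r scale0r; apply: le_trans (Sym_norm_ge _ (v := fun=> 0) _).
    exact: normr_ge0.
  by move=> i; rewrite normr0.
rewrite -ler_pdivlMl ?normr_gt0// -normfV; apply: le_trans (le _ _).
by rewrite scalerA mulVf// scale1r.
Qed.

Fact Sym_normr0_eq0 (S : Sym) : Sym_norm S = 0 -> S = 0.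
Proof.
move=> S0; apply: Sym_inj => v.
pose c i := 1 + `|v i|.
have c0 i : 0 < c i by rewrite ltr_pwDl.
have -> : S v = S (fun i => c i *: ((c i)^-1 *: v i)).
  congr (Sym_fun S _); apply/funext => i.
  by rewrite scalerA divff ?scale1r// gt_eqF.
rewrite Sym_scale.
have : `|S (fun i => (c i)^-1 *: v i)| <= 0.
  rewrite -S0; apply: Sym_norm_ge => i.
  by rewrite normrZ normfV gtr0_norm// ler_pdivrMl// mulr1 /c lerDr.
by rewrite normr_le0 => /eqP ->; rewrite scaler0.
Qed.

HB.instance Definition _ := Lmodule_isNormed.Build R Sym
  Sym_ler_normD Sym_normrZ Sym_normr0_eq0.

End SymmetricMultilinear.

Arguments Sym {R} k G E.

Lemma diff_lin {R : realType} {V W : normedModType R} (f g : V -> W) (a : R) x :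
  differentiable f x -> differentiable g x ->
  differentiable (a *: f + g) x /\
  forall u, 'd (a *: f + g) x u = a *: 'd f x u + 'd g x u.
Proof.
move=> df dg; have daf : differentiable (a *: f) x by exact: differentiableZ.
split; first exact: differentiableD.
by move=> u; rewrite diffD// diffZ.
Qed.

Section FrechetDerivatives.
Context {R : realType} {G E : normedModType R} {X : set G}.

Fact Sym_const_subproof (c : E) : (fun=> c) \in @symmultilin R 0 G E.
Proof.
apply/symmultilinP; split=> [v [] //|//|].
by exists `|c| => v; rewrite big_ord0 mulr1.
Qed.

(* The isometry from E onto Sym 0 G E. *)
Definition Sym_const (c : E) : Sym 0 G E := MkSym (Sym_const_subproof c).

Definition fcons k (u : G) (v : 'I_k -> G) : 'I_k.+1 -> G :=
  fun i => oapp v u (unlift ord0 i).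

(* L is the Frechet derivative of g at x, a bounded linear map from G to
   Sym k G E seen as a (k+1)-linear map. The extension of g by 0 outside X is
   only a device to use the library differential, which is defined for total
   functions: for X open it does not affect the derivative at points of X. *)
Definition is_Sym_derivative k (g : X -> Sym k G E) (x : X)
    (L : Sym k.+1 G E) : Prop :=
  differentiable (valL_ 0 g) (set_val x) /\
  forall (u : G) (v : 'I_k -> G),
    ('d (valL_ 0 g) (set_val x) u : Sym k G E) v = L (fcons u v).

(* Dn k f x is D^k f(x); by convention it is 0 when D^k f(x) does not exist. *)
Fixpoint Dn (k : nat) (f : X -> E) : X -> Sym k G E :=
  match k with
  | 0 => fun x => Sym_const (f x)
  | k'.+1 => fun x => xget 0 [set L | is_Sym_derivative (Dn k' f) x L]
  end.

Definition is_Cp (p : smooth_order) (f : X -> E) : Prop :=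
  (forall k, in_N p k.+1 -> forall x, exists L, is_Sym_derivative (Dn k f) x L)
  /\ (forall k, in_N p k -> continuous (Dn k f)).

Lemma is_Sym_derivative_unique k (g : X -> Sym k G E) x L L' :
  is_Sym_derivative g x L -> is_Sym_derivative g x L' -> L = L'.
Proof.
move=> [_ h] [_ h']; apply: Sym_inj => v.
have -> : v = fcons (v ord0) (v \o lift ord0).
  apply/funext => i; rewrite /fcons.
  by case: unliftP => [j|] ->.
by rewrite -h h'.
Qed.

Lemma DnSE k (f : X -> E) x L :
  is_Sym_derivative (Dn k f) x L -> Dn k.+1 f x = L.
Proof.
by move=> fL; apply: xget_unique => // L' /is_Sym_derivative_unique; exact.
Qed.

Lemma is_Sym_derivative0 k x :
  is_Sym_derivative (0 : X -> Sym k G E) x (0 : Sym k.+1 G E).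
Proof.
have e : valL_ 0 (0 : X -> Sym k G E) = cst 0 :> (G -> Sym k G E).
  by apply/funext => z; rewrite /valL_ oinv_set_val /=; case: insub.
by split; rewrite e //= => u v; rewrite diff_cst.
Qed.

Lemma is_Sym_derivative_lin k (g h : X -> Sym k G E) x L M (a : R) :
  is_Sym_derivative g x L -> is_Sym_derivative h x M ->
  is_Sym_derivative (a *: g + h) x (a *: L + M).
Proof.
move=> [dg gL] [dh hM].
have e : valL_ 0 (a *: g + h) = a *: valL_ 0 g + valL_ 0 h :> (G -> Sym k G E).
  apply/funext => z; rewrite !fctE /valL_ oinv_set_val /=.
  by case: insub => //=; rewrite scaler0 addr0.
have [dgh dghE] := diff_lin a dg dh.
rewrite /is_Sym_derivative e; split; first exact: dgh.
move=> u v; rewrite dghE; apply: etrans (SymE _ _ _ _) _.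
exact: (congr2 (fun s t => a *: s + t) (gL u v) (hM u v)).
Qed.

Lemma Dn_lin p (f g : X -> E) (a : R) k : is_Cp p f -> is_Cp p g -> in_N p k ->
  Dn k (a *: f + g) = a *: Dn k f + Dn k g.
Proof.
move=> [df _] [dg _]; elim: k => [_|k IH kp].
  by apply/funext => x; apply: Sym_inj.
apply/funext => x; have [L fL] := df _ kp x; have [M gM] := dg _ kp x.
rewrite !fctE (DnSE fL) (DnSE gM); apply: DnSE.
by rewrite (IH (in_NS kp)); exact: (is_Sym_derivative_lin a fL gM).
Qed.

Lemma Dn_cst0 k : Dn k (0 : X -> E) = 0.
Proof.
elim: k => [|k IH]; first by apply/funext => x; apply: Sym_inj.
by apply/funext => x; apply: DnSE; rewrite IH; exact: is_Sym_derivative0.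
Qed.

Definition Cp_pred (p : smooth_order) : {pred X -> E} :=
  [pred f | `[< is_Cp p f >]].

Lemma Cp_predP p f : f \in Cp_pred p <-> is_Cp p f.
Proof. by rewrite unfold_in; split => /asboolP. Qed.

Lemma Cp_submod p : submod_closed (Cp_pred p).
Proof.
split.
  apply/Cp_predP; split=> [k _ x|k _].
    by exists 0; rewrite Dn_cst0; exact: is_Sym_derivative0.
  by rewrite Dn_cst0; exact: cst_continuous.
move=> a f g /Cp_predP fp /Cp_predP gp; apply/Cp_predP.
split=> [k kp x|k kp].
  have [[/(_ _ kp x)[L fL] _] [/(_ _ kp x)[M gM] _]] := (fp, gp).
  exists (a *: L + M); rewrite (Dn_lin _ fp gp (in_NS kp)).
  exact: (is_Sym_derivative_lin a fL gM).
rewrite (Dn_lin _ fp gp kp).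
have [[_ /(_ _ kp) cf] [_ /(_ _ kp) cg]] := (fp, gp).
move=> x; apply: (@cvgD _ _ _ (nbhs x) _ (a *: Dn k f) (Dn k g)).
  by apply: (@cvgZl_tmp _ _ _ (nbhs x) _ a (Dn k f)); exact: cf.
exact: cg.
Qed.

End FrechetDerivatives.

Section SpaceCp.
Context {R : realType} {G : normedModType R} (X : set G) (E : normedModType R)
  (p : smooth_order).

Record Cp := MkCp { Cp_fun :> X -> E; Cp_funP : Cp_fun \in Cp_pred p }.

HB.instance Definition _ := [isSub for Cp_fun].
HB.instance Definition _ := [Choice of Cp by <:].
HB.instance Definition _ :=
  GRing.isSubmodClosed.Build R _ (@Cp_pred R G E X p) (Cp_submod p).
HB.instance Definition _ := [SubChoice_isSubLmodule of Cp by <:].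

Definition rho (K : set X) (k : nat) (f : X -> E) : R :=
  sup [set \big[Num.max/0]_(j < k.+1) `|Dn j f x| | x in K].

Definition Cp_subbase : set (set Cp) :=
  [set B | exists (f : Cp) (K : set X) (k : nat) (e : R),
    [/\ compact K, in_N p k, 0 < e & B = [set g : Cp | rho K k (g - f) < e]]].

HB.instance Definition _ := isSubBaseTopological.Build Cp Cp_subbase id.

End SpaceCp.

Section Operators.
Context {R : realType}.

Definition compact_operator (V W : preTopologicalLmodType R) (T : V -> W) :=
  linear T /\
  exists U : set V, [/\ open U, U !=set0 & precompact (T @` U)].

Definition bounded_linear_operator (V W : normedModType R) (A : V -> W) :=
  linear A /\ exists M : R, forall v, `|A v| <= M * `|v|.

Definition operator_norm (V W : normedModType R) (A : V -> W) : R :=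
  sup [set `|A v| | v in [set v : V | `|v| <= 1]].

Definition operator_norm_continuous (Y : topologicalType)
    (V W : normedModType R) (A : Y -> V -> W) :=
  (forall y, bounded_linear_operator (A y)) /\
  (forall y, operator_norm (A z - A y) @[z --> y] --> (0 : R)).

Definition disjoint_functions (T : Type) (V : zmodType) (f g : T -> V) :=
  forall t, f t = 0 \/ g t = 0.

Definition separating (G H E F : normedModType R) (X : set G) (Y : set H) p q
    (T : Cp X E p -> Cp Y F q) :=
  forall f g : Cp X E p,
    disjoint_functions (f : X -> E) (g : X -> E) ->
    disjoint_functions (T f : Y -> F) (T g : Y -> F).

Definition nowhere_trivial (G H E F : normedModType R) (X : set G) (Y : set H)
    p q (T : Cp X E p -> Cp Y F q) :=
  forall y, exists f, T f y != 0.

Definition has_bump (G : normedModType R) (p : smooth_order) :=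
  exists phi : Cp [set: G] R^o p,
    [/\ forall x : [set: G], `|set_val x| <= 2^-1 -> phi x = 1,
        forall x : [set: G], 1 <= `|set_val x| -> phi x = 0
      & forall k, in_N p k -> exists M : R, forall x, `|Dn k phi x| <= M].

(* DPhi m Phi y is D_y^m Phi(y, .) *)
Definition DPhi (V : Type) (H F : normedModType R) (Y : set H) (m : nat)
    (Phi : Y -> V -> F) (y : Y) : V -> Sym m H F :=
  fun S => Dn m (fun z => Phi z S) y.

Definition admissible (V H F : normedModType R) (Y : set H) (q : smooth_order)
    (Phi : Y -> V -> F) :=
  [/\ forall y, bounded_linear_operator (Phi y),
      forall S, is_Cp q (fun y => Phi y S),
      forall y m, in_N q m -> compact_operator (DPhi m Phi y)
    & forall m, in_N q m -> operator_norm_continuous (DPhi m Phi)].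

Definition representable (G H E F : normedModType R) (X : set G) (Y : set H)
    p q (T : Cp X E p -> Y -> F) :=
  exists (l : nat) (Phi : forall k, Y -> Sym k G E -> F)
    (I : Type) (x_ : I -> X) (Y_ : I -> set Y),
    [/\ in_N p l,
        precompact (range x_),
        partition [set: I] Y_ [set: Y] /\ (forall i, clopen (Y_ i)),
        forall (f : Cp X E p) i y, Y_ i y ->
          T f y = \sum_(k < l.+1) Phi k y (Dn k f (x_ i))
      & forall k, (k <= l)%N -> admissible q (Phi k)].

End Operators.

(* Main.v *)
From HB Require Import structures.
From mathcomp Require Import all_fingroup finmap.
Require Import Defs.
From mathcomp Require Import all_boot all_order all_algebra.
From mathcomp Require Import all_classical all_reals all_analysis.
From mathcomp Require Import ring lra.

Set Implicit Arguments.
Unset Strict Implicit.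
Unset Printing Implicit Defensive.

Import Order.TTheory GRing.Theory Num.Theory.
Import numFieldNormedType.Exports.

Local Open Scope classical_set_scope.
Local Open Scope ring_scope.

(** Let T be compact, separating and nowhere trivial. Since T maps some ball
    {rho K l < e} onto a relatively compact set, each D^m(Tf)(y) is bounded by a
    multiple of rho K l f, and the functions D^m(Tf) are equicontinuous at y with
    modulus proportional to rho K l f (compact_operator_estimates).

    In particular Tf = 0 when f vanishes near the compact set K. A finite cover of K
    by bumps then yields, for each y, a point h(y) of K such that Tf(y) = 0 as soon as
    f vanishes near h(y) (support_point_exists): otherwise each point of K has a
    neighbourhood on which f can be replaced by 0 without changing Tf(y), because T
    is separating. So f may be multiplied by a bump of radius 1/la around h(y), and
    for a function whose derivatives of order at most l vanish at h(y), rho K l of the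
    product tends to 0 as la grows; hence Tf(y) depends only on the l-jet of f at h(y)
    (flat_support_point). Subtracting the Taylor polynomial gives the representation
    with Phi_k(y, S) = T(S(. - h(y), ..., . - h(y)) / k!)(y) (representation).

    The key point is that h is locally constant. Some Phi_r(y0, S) is nonzero. The
    product f_la of the corresponding monomial with a bump of radius 1/la at h(y0)
    has rho K l f_la = O(la^(l-r)), whereas T f_la(y0) = Phi_r(y0, S) does not depend
    on la. If h(y) differs from h(y0), take 1/la of the order of |h(y) - h(y0)|, so
    that T f_la vanishes near y. As l - r <= p <= q, the derivative of order l - r of
    T f_la is available, it is 0 at y, and by equicontinuity it is o(la^(l-r)) near
    y0. Integrating it from y to y0 bounds T f_la(y0) by o((la |y - y0|)^(l-r)).
    Hence |h(y) - h(y0)| = o(|y - y0|): h has derivative 0 everywhere, and is locally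
    constant by the mean value inequality (support_point_derivative,
    support_point_locally_constant). The fibres of h form the partition, and
    the regularity of Phi_k follows from that of T on monomials (Phi_admissible).

    Conversely, on a clopen piece Tf is a finite sum of functions Phi_k(., S), so Tf is
    of class C^q, and the ball {rho K l < 1}, K the closure of the points x_alpha, has
    pointwise precompact and equicontinuous derivatives under T. The Arzela-Ascoli
    theorem for C^q (Cp_ascoli) makes its image precompact: an equicontinuous family
    of derivatives makes the lower ones uniformly differentiable, so that pointwise
    limits keep their derivatives. T is separating because disjointness of f and g
    passes to all their derivatives (disjoint_Dn).

    The derivatives are symmetric multilinear maps, and the jets of products and of
    homogeneous polynomials have to be produced in that form. They are built by
    recursion on the order: a symmetric (k+1)-linear map is a linear map u |-> S(u, .)
    into the symmetric k-linear maps for which the first two arguments commute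
    (uncurry_exists), so a jet is determined by its contractions with one vector. *)

(** * Equalities between linear combinations *)

Section LinearExpressions.
Context {R : pzRingType} {V : lmodType R}.

Inductive linexp :=
| LinAtom of nat | LinZero | LinAdd of linexp & linexp | LinOpp of linexp
| LinScale of R & linexp.

Fixpoint lin_eval (env : seq V) (e : linexp) : V :=
  match e with
  | LinAtom n => env`_n
  | LinZero => 0
  | LinAdd e1 e2 => lin_eval env e1 + lin_eval env e2
  | LinOpp e1 => - lin_eval env e1
  | LinScale a e1 => a *: lin_eval env e1
  end.

Fixpoint lin_coef (e : linexp) (i : nat) : R :=
  match e with
  | LinAtom n => if i == n then 1 else 0
  | LinZero => 0
  | LinAdd e1 e2 => lin_coef e1 i + lin_coef e2 i
  | LinOpp e1 => - lin_coef e1 i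
  | LinScale a e1 => a * lin_coef e1 i
  end.

Lemma lin_evalE env e :
  lin_eval env e = \sum_(i < size env) lin_coef e i *: env`_i.
Proof.
elim: e => [n||e1 IH1 e2 IH2|e IH|a e IH] /=.
- have [nlt|nge] := ltnP n (size env).
    rewrite (bigD1 (Ordinal nlt))//= eqxx scale1r big1 ?addr0// => i.
    by rewrite -val_eqE /= => /negbTE ->; rewrite scale0r.
  rewrite nth_default// big1// => i _; rewrite ltn_eqF ?scale0r//.
  exact: leq_trans (ltn_ord i) nge.
- by rewrite big1// => i _; rewrite scale0r.
- by rewrite IH1 IH2 -big_split; apply: eq_bigr => i _; rewrite scalerDl.
- by rewrite IH -sumrN; apply: eq_bigr => i _; rewrite scaleNr.
- by rewrite IH scaler_sumr; apply: eq_bigr => i _; rewrite scalerA.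
Qed.

Fixpoint lin_same_coef (e1 e2 : linexp) (n : nat) : Prop :=
  if n is n'.+1 then
    lin_coef e1 n' = lin_coef e2 n' /\ lin_same_coef e1 e2 n'
  else True.

(** Soundness of the tactic below, which reifies both sides of an equality in a module
    and leaves one ring equality per vector. *)
Lemma lin_eval_eq env e1 e2 :
  lin_same_coef e1 e2 (size env) -> lin_eval env e1 = lin_eval env e2.
Proof.
rewrite !lin_evalE => h; apply: eq_bigr => i _; congr (_ *: _).
elim: (size env) h i => [_ []//|n IH /= [hn h] i].
have [->//|ni] := eqVneq (nat_of_ord i) n.
have lt : (i < n)%N by rewrite ltn_neqAle ni -ltnS ltn_ord.
exact: (IH h (Ordinal lt)).
Qed.

End LinearExpressions.

Ltac lin_mem x l :=
  lazymatch l with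
  | nil => constr:(false)
  | x :: _ => constr:(true)
  | _ :: ?l' => lin_mem x l'
  end.
Ltac lin_index x l :=
  lazymatch l with
  | x :: _ => constr:(0%N)
  | _ :: ?l' => let n := lin_index x l' in constr:(S n)
  end.
Ltac lin_atoms t l :=
  lazymatch t with
  | (?x + ?y)%R => let l1 := lin_atoms x l in lin_atoms y l1
  | (- ?x)%R => lin_atoms x l
  | (?a *: ?x)%R => lin_atoms x l
  | 0%R => l
  | _ => let b := lin_mem t l in
         lazymatch b with true => l | false => constr:(t :: l) end
  end.
Ltac lin_reify K t l :=
  lazymatch t with
  | (?x + ?y)%R => let ex := lin_reify K x l in let ey := lin_reify K y l in
      constr:(@LinAdd K ex ey)
  | (- ?x)%R => let ex := lin_reify K x l in constr:(@LinOpp K ex)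
  | (?a *: ?x)%R => let ex := lin_reify K x l in constr:(@LinScale K a ex)
  | 0%R => constr:(@LinZero K)
  | _ => let n := lin_index t l in constr:(@LinAtom K n)
  end.

Tactic Notation "linear_combination" constr(K) :=
  lazymatch goal with
  | |- @eq ?V ?x ?y =>
    let l0 := lin_atoms x (@nil V) in
    let l := lin_atoms y l0 in
    let ex := lin_reify K x l in
    let ey := lin_reify K y l in
    apply: (@lin_eval_eq K _ l ex ey); rewrite /=;
    repeat (split; [by ring|]); exact: I
  end.


(** * The mean value inequality *)

Section PathLipschitz.
Context {R : realType} {W : normedModType R}.

(** The supremum s of the times t with |g t - g 0| <= c t belongs to this set by the local
    bound on the left of s, and s < 1 is excluded by the local bound on the right. *)
Lemma local_lipschitz_path (g : R -> W) (c : R) :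
  (forall t, 0 <= t <= 1 -> exists2 d, 0 < d & forall s, 0 <= s <= 1 ->
     `|s - t| < d -> `|g s - g t| <= c * `|s - t|) ->
  `|g 1 - g 0| <= c.
Proof.
move=> gc.
pose A : set R := [set t | 0 <= t <= 1 /\ `|g t - g 0| <= c * t].
have A0 : A 0 by rewrite /A /= lexx ler01 subrr normr0 mulr0.
have supA : has_sup A.
  by split; [exists 0 | exists 1 => t [/andP[]]].
set s := sup A.
have s01 : 0 <= s <= 1.
  apply/andP; split; first exact: (ub_le_sup supA.2).
  by apply: ge_sup => [|t [/andP[]]//]; exists 0.
have [d d0 sd] := gc _ s01.
have As : A s.
  split=> //; have [t At st] := sup_adherent d0 supA.
  have ts : t <= s by apply: (ub_le_sup supA.2).
  case: At => t01 gt; rewrite -(subrK (g t) (g s)) -addrA.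
  have -> : c * s = c * `|t - s| + c * t.
    by rewrite ler0_norm ?subr_le0//; ring.
  rewrite (le_trans (ler_normD _ _))// lerD// distrC.
  apply: sd => //; rewrite ler0_norm ?subr_le0//.
  by rewrite -/s in st; lra.
have [s1|s1] := ltP s 1; last first.
  have -> : 1 = s by apply/eqP; rewrite eq_le s1; case/andP: s01.
  by case: As => _ /le_trans; apply; have -> : s = 1; [lra|rewrite mulr1].
pose s' := Num.min 1 (s + d / 2).
have ss' : s < s' by rewrite lt_min s1 ltrDl divr_gt0.
have s's : s' - s < d.
  by rewrite ltrBlDl (@le_lt_trans _ _ (s + d / 2)) ?ge_min ?lexx ?orbT//; lra.
have s'01 : 0 <= s' <= 1.
  rewrite ge_min lexx /= andbT; apply: ltW; apply: le_lt_trans ss'.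
  by case/andP: s01.
have : A s'.
  split=> //; rewrite -(subrK (g s) (g s')) -addrA.
  have -> : c * s' = c * `|s' - s| + c * s.
    by rewrite gtr0_norm ?subr_gt0//; ring.
  rewrite (le_trans (ler_normD _ _))// lerD//; last by case: As.
  by apply: sd => //; rewrite gtr0_norm ?subr_gt0.
by move=> /(ub_le_sup supA.2); rewrite leNgt ss'.
Qed.

End PathLipschitz.

Section OpenSubtype.
Context {R : realType} {G : normedModType R} {X : set G}.

Lemma near_subtypeP (x : X) (A : set X) : (\forall z \near x, A z) <->
  exists2 d : R, 0 < d & forall z : X, `|val z - val x| < d -> A z.
Proof.
split=> [/nbhs_ballP[d /= d0 dA]|[d d0 dA]].
  by exists d => // z zx; apply: dA; rewrite /ball/= /initial_ball -ball_normE/= distrC.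
apply/nbhs_ballP; exists d => //= z.
by rewrite /ball/= /initial_ball -ball_normE/= distrC; exact: dA.
Qed.

Hypothesis Xo : open X.

Lemma open_ball_sub (x : X) :
  exists2 r : R, 0 < r & forall z, `|z - val x| < r -> X z.
Proof.
have /nbhs_ballP[r /= r0 rX] : nbhs (val x) X.
  by apply: open_nbhs_nbhs; split => //; exact: set_valP.
by exists r => // z zx; apply: rX; rewrite -ball_normE /= distrC.
Qed.

End OpenSubtype.

Lemma segment_ball {R : realType} {G : normedModType R} (a b c : G) (r t : R) :
  `|a - c| < r -> `|b - c| < r -> 0 <= t <= 1 -> `|a + t *: (b - a) - c| < r.
Proof.
move=> ar br /andP[t0 t1].
have -> : a + t *: (b - a) - c = (1 - t) *: (a - c) + t *: (b - c).
  by linear_combination R.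
rewrite (le_lt_trans (ler_normD _ _))// !normrZ ger0_norm ?subr_ge0// ger0_norm//.
have [->|t1'] := eqVneq t 1; first by rewrite subrr mul0r mul1r add0r.
have t1lt : t < 1 by rewrite lt_neqAle t1'.
rewrite [ltRHS](_ : r = (1 - t) * r + t * r); last by ring.
by rewrite ltr_leD ?ltr_pM2l ?subr_gt0// ler_wpM2l// ltW.
Qed.

(** The segment is parametrized by t |-> a + t(b - a) in X, which insubd
    lifts to the subtype. *)
Lemma mean_value_segment {R : realType} {G W : normedModType R} {X : set G}
    (g : X -> W) (M : R) (a b : X) :
  (forall t, 0 <= t <= 1 -> X (val a + t *: (val b - val a))) ->
  (forall (z : X) t, 0 <= t <= 1 -> val z = val a + t *: (val b - val a) ->
     forall e, 0 < e ->
     \forall z' \near z, `|g z' - g z| <= (M + e) * `|val z' - val z|) ->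
  `|g b - g a| <= M * `|val b - val a|.
Proof.
move=> abX gM.
have [ab|ab] := eqVneq (val a) (val b).
  by rewrite (val_inj ab) !subrr !normr0 mulr0.
have ab0 : 0 < `|val b - val a| by rewrite normr_gt0 subr_eq0 eq_sym.
rewrite -ler_pdivrMr//; apply/ler_addgt0Pr => e e0; rewrite ler_pdivrMr//.
pose p t := val a + t *: (val b - val a).
pose q t : X := insubd a (p t).
have qE t : 0 <= t <= 1 -> val (q t) = p t.
  by move=> t01; rewrite insubdK// inE; exact: abX.
have p0 : p 0 = val a by rewrite /p scale0r addr0.
have p1 : p 1 = val b by rewrite /p scale1r; linear_combination R.
have q0 : q 0 = a by apply: val_inj; rewrite qE ?lexx ?ler01.
have q1 : q 1 = b by apply: val_inj; rewrite qE ?lexx ?ler01.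
suff : `|(g \o q) 1 - (g \o q) 0| <= (M + e) * `|val b - val a|.
  by rewrite /= q0 q1.
apply: (@local_lipschitz_path _ _ (g \o q)) => t t01.
have [d d0 dg] := (near_subtypeP _ _).1 (gM (q t) t t01 (qE t t01) e e0).
exists (d / `|val b - val a|); first exact: divr_gt0.
move=> s s01 st.
have pst : val (q s) - val (q t) = (s - t) *: (val b - val a).
  by rewrite !qE// /p; linear_combination R.
rewrite mulrAC -mulrA -normrZ -pst.
by apply: dg; rewrite pst normrZ -ltr_pdivlMr.
Qed.

(** * Symmetric multilinear maps and their contractions *)

Section Contraction.
Context {R : realType} {G E : normedModType R}.

Lemma fcons0 k (u : G) (v : 'I_k -> G) : fcons u v ord0 = u.
Proof. by rewrite /fcons unlift_none. Qed.

Lemma fconsS k (u : G) (v : 'I_k -> G) i : fcons u v (lift ord0 i) = v i.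
Proof. by rewrite /fcons liftK. Qed.

Lemma fconsK k (v : 'I_k.+1 -> G) : fcons (v ord0) (v \o lift ord0) = v.
Proof.
by apply/funext => i; case: (unliftP ord0 i) => [j|] ->; rewrite ?fconsS ?fcons0.
Qed.

Lemma fcons_dfwith k (u : G) (v : 'I_k -> G) i w :
  fcons u (@dfwith _ (fun=> G) v i w) =
  @dfwith _ (fun=> G) (fcons u v) (lift ord0 i) w.
Proof.
apply/funext => j; case: (unliftP ord0 j) => [j'|] ->; last first.
  by rewrite dfwithout ?fcons0// neq_lift.
rewrite fconsS; have [->|ne] := eqVneq i j'; first by rewrite !dfwithin.
by rewrite !dfwithout ?fconsS// (inj_eq lift_inj).
Qed.

Lemma fcons_dfwith0 k (u w : G) (v : 'I_k -> G) :
  fcons u v = @dfwith _ (fun=> G) (fcons w v) ord0 u.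
Proof.
apply/funext => j; case: (unliftP ord0 j) => [j'|] ->; last first.
  by rewrite dfwithin fcons0.
by rewrite dfwithout ?fconsS// eq_sym neq_lift.
Qed.

Lemma prod_fcons k (u : G) (v : 'I_k -> G) :
  \prod_(i < k.+1) `|fcons u v i| = `|u| * \prod_(i < k) `|v i|.
Proof.
rewrite big_ord_recl fcons0; congr (_ * _).
by apply: eq_bigr => i _; rewrite fconsS.
Qed.

(** Rescale the entries of v to norm at most 1; a zero entry is 0 times its rescaling. *)
Lemma Sym_norm_prod k (S : Sym k G E) v : `|S v| <= `|S| * \prod_(i < k) `|v i|.
Proof.
have -> : S v = S (fun i => `|v i| *: (`|v i|^-1 *: v i)).
  congr (Sym_fun S _); apply/funext => i; rewrite scalerA.
  have [->|vi0] := eqVneq (v i) 0; first by rewrite scaler0.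
  by rewrite divff ?scale1r// normr_eq0.
rewrite Sym_scale normrZ normr_prod mulrC.
under eq_bigr do rewrite normr_id.
rewrite ler_wpM2r ?prodr_ge0//; apply: Sym_norm_ge => i.
rewrite normrZ normfV normr_id; have [->|vi0] := eqVneq (v i) 0.
  by rewrite normr0 mulr0.
by rewrite mulVf// normr_eq0.
Qed.

Lemma Sym_norm_le_prod k (S : Sym k G E) M : 0 <= M ->
  (forall v, `|S v| <= M * \prod_(i < k) `|v i|) -> `|S| <= M.
Proof.
move=> M0 SM; apply: Sym_norm_le => v v1; apply: le_trans (SM v) _.
by rewrite ler_piMr//; apply: prodr_ile1 => i _; rewrite normr_ge0 v1.
Qed.

Fact contr_subproof k (u : G) (S : Sym k.+1 G E) :
  (fun v : 'I_k -> G => S (fcons u v)) \in @symmultilin R k G E.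
Proof.
have [mS sS _] := SymP S.
apply/symmultilinP; split=> [v i a w w'|s v|].
- by rewrite !fcons_dfwith mS.
- rewrite -[in RHS](sS (lift_perm ord0 ord0 s)); congr (Sym_fun S _).
  apply/funext => j; case: (unliftP ord0 j) => [j'|] -> /=.
    by rewrite lift_perm_lift !fconsS.
  by rewrite lift_perm_id !fcons0.
- exists (`|S| * `|u|) => v; rewrite -mulrA -prod_fcons.
  exact: Sym_norm_prod.
Qed.

Definition contr k (u : G) (S : Sym k.+1 G E) : Sym k G E :=
  MkSym (contr_subproof u S).

Lemma contrE k u (S : Sym k.+1 G E) v : contr u S v = S (fcons u v).
Proof. by []. Qed.

Lemma eq_contr k (S T : Sym k.+1 G E) :
  (forall u, contr u S = contr u T) -> S = T.
Proof.
by move=> ST; apply: Sym_inj => v; rewrite -(fconsK v) -!contrE ST.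
Qed.

(** The contraction as a function of the vector, to be given a linear structure. *)
Definition contrl k (S : Sym k.+1 G E) (u : G) := contr u S.

Lemma contr_linl k (S : Sym k.+1 G E) : linear (contrl S).
Proof.
move=> a u w; apply: Sym_inj => v; have [mS _ _] := SymP S.
rewrite SymE /contrl !contrE (fcons_dfwith0 _ 0) mS.
by rewrite -!fcons_dfwith0.
Qed.
HB.instance Definition _ k (S : Sym k.+1 G E) :=
  GRing.isLinear.Build R G (Sym k G E) _ (contrl S) (contr_linl S).

Lemma contrPl k a (u w : G) (S : Sym k.+1 G E) :
  contr (a *: u + w) S = a *: contr u S + contr w S.
Proof. exact: contr_linl. Qed.

Lemma contrPr k a (u : G) (S T : Sym k.+1 G E) :
  contr u (a *: S + T) = a *: contr u S + contr u T.
Proof. by apply: Sym_inj. Qed.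

Lemma contrDl k (u w : G) (S : Sym k.+1 G E) : contr (u + w) S = contr u S + contr w S.
Proof. exact: (raddfD (contrl S)). Qed.

Lemma contrBl k (u w : G) (S : Sym k.+1 G E) : contr (u - w) S = contr u S - contr w S.
Proof. exact: (raddfB (contrl S)). Qed.

Lemma contrZl k a (u : G) (S : Sym k.+1 G E) : contr (a *: u) S = a *: contr u S.
Proof. exact: (linearZ_LR (contrl S)). Qed.

Lemma contrDr k (u : G) (S T : Sym k.+1 G E) : contr u (S + T) = contr u S + contr u T.
Proof. by apply: Sym_inj. Qed.

Lemma contrBr k (u : G) (S T : Sym k.+1 G E) : contr u (S - T) = contr u S - contr u T.
Proof. by apply: Sym_inj. Qed.

Lemma contrZr k a (u : G) (S : Sym k.+1 G E) : contr u (a *: S) = a *: contr u S.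
Proof. by apply: Sym_inj. Qed.

Lemma contr0r k (u : G) : contr u (0 : Sym k.+1 G E) = 0.
Proof. by apply: Sym_inj. Qed.

Lemma norm_contr k u (S : Sym k.+1 G E) : `|contr u S| <= `|S| * `|u|.
Proof.
apply: Sym_norm_le_prod => [|v]; first by rewrite mulr_ge0.
by rewrite contrE -mulrA -prod_fcons; exact: Sym_norm_prod.
Qed.

Lemma norm_le_contr k (S : Sym k.+1 G E) M : 0 <= M ->
  (forall u, `|contr u S| <= M * `|u|) -> `|S| <= M.
Proof.
move=> M0 SM; apply: Sym_norm_le_prod => // v.
rewrite -[in `|S v|](fconsK v) -contrE.
apply: le_trans (Sym_norm_prod _ _) _.
by rewrite big_ord_recl mulrA ler_wpM2r// prodr_ge0.
Qed.

Lemma contrC k u w (S : Sym k.+2 G E) : contr u (contr w S) = contr w (contr u S).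
Proof.
apply: Sym_inj => v; rewrite !contrE; have [_ sS _] := SymP S.
rewrite -(sS (tperm ord0 (lift ord0 ord0))); congr (Sym_fun S _).
apply/funext => i /=; case: (unliftP ord0 i) => [j|] ->; last first.
  by rewrite tpermL fconsS !fcons0.
case: (unliftP ord0 j) => [j'|] ->; last by rewrite tpermR fconsS !fcons0.
by rewrite tpermD ?fconsS// ?neq_lift// (inj_eq lift_inj) neq_lift.
Qed.

(** The transposition of the first two indices and the permutations that fix the first
    one generate the symmetric group. *)
Lemma symmetric_fcons k (S : ('I_k.+2 -> G) -> E) :
  (forall u (s : 'S_k.+1) v, S (fcons u (v \o s)) = S (fcons u v)) ->
  (forall u w v, S (fcons u (fcons w v)) = S (fcons w (fcons u v))) ->
  symmetric_map S.
Proof.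
move=> S0 S01.
have Sfix (s : 'S_k.+2) v : s ord0 = ord0 -> S (v \o s) = S v.
  move=> s0; rewrite -[in RHS](fconsK v) -(fconsK (v \o s)) /= s0.
  have sl l : exists l', s (lift ord0 l) = lift ord0 l'.
    case: (unliftP ord0 (s (lift ord0 l))) => [l'|]; first by exists l'.
    rewrite -[X in _ = X -> _]s0 => /perm_inj /eqP.
    by rewrite eq_sym (negbTE (neq_lift _ _)).
  have inj : injective (fun i : 'I_k.+1 => odflt ord0 (unlift ord0 (s (lift ord0 i)))).
    move=> i j; have [i' Ei] := sl i; have [j' Ej] := sl j.
    rewrite Ei Ej !liftK /= => ij.
    by apply: (@lift_inj _ ord0); apply: (@perm_inj _ s); rewrite Ei Ej ij.
  rewrite -[in RHS](S0 _ (perm inj)); congr (S (fcons _ _)); apply/funext => i /=.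
  by rewrite permE; have [i' ->] := sl i; rewrite liftK.
pose o1 : 'I_k.+2 := lift ord0 ord0.
have St v : S (v \o tperm ord0 o1) = S v.
  rewrite -(fconsK v) -(fconsK (v \o lift ord0)).
  rewrite -[in RHS]S01; congr S.
  apply/funext => i /=; case: (unliftP ord0 i) => [j|] ->; last first.
    by rewrite tpermL fconsS !fcons0.
  case: (unliftP ord0 j) => [j'|] ->; last by rewrite tpermR !fconsS !fcons0.
  by rewrite tpermD ?fconsS// ?neq_lift// (inj_eq lift_inj) neq_lift.
move=> s v.
have [s0|s0] := eqVneq (s ord0) ord0; first exact: Sfix.
pose t1 : 'S_k.+2 := tperm (s ord0) o1.
have t10 : t1 ord0 = ord0 by rewrite tpermD// eq_sym.
(* t1 brings the image of the first index to the second one, hence it remains to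
   exchange the first two indices to get a permutation that fixes the first one. *)
have -> : v \o s = (((v \o t1) \o tperm ord0 o1) \o
  (s * t1 * tperm ord0 o1)%g :> ('I_k.+2 -> G)).
  by apply/funext => i /=; rewrite !permM tpermK /t1 tpermK.
rewrite (Sfix (s * t1 * tperm ord0 o1)%g); last first.
  by rewrite !permM /t1 tpermL tpermR.
by rewrite St Sfix.
Qed.

(** The condition for u |-> L u, of values in the k-linear symmetric maps, to come from a
    symmetric (k+1)-linear map; it is void for k = 0. *)
Definition swap_compatible k : (G -> Sym k G E) -> Prop :=
  match k with
  | 0 => fun=> True
  | k'.+1 => fun L => forall u w, contr u (L w) = contr w (L u)
  end.

(** Symmetry in the last arguments comes from L u, and exchanging the first two is the
    swap condition. *)
Lemma uncurry_exists k (L : G -> Sym k G E) M : linear L ->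
  (forall u, `|L u| <= M * `|u|) -> swap_compatible L ->
  exists S : Sym k.+1 G E, forall u, contr u S = L u.
Proof.
move=> linL LM symL.
pose S (v : 'I_k.+1 -> G) := L (v ord0) (v \o lift ord0).
have SE u v : S (fcons u v) = L u v.
  rewrite /S fcons0; congr (L u _); apply/funext => i; exact: fconsS.
suff HS : S \in @symmultilin R k.+1 G E.
  by exists (MkSym HS) => u; apply: Sym_inj => v; exact: SE.
apply/symmultilinP; split=> [v i a u w||].
- case: (unliftP ord0 i) => [j|] ->; last first.
    by rewrite -(fconsK v) -!fcons_dfwith0 !SE linL.
  rewrite -(fconsK v) -!fcons_dfwith !SE.
  by have [mL _ _] := SymP (L (v ord0)); exact: mL.
- case: k L linL LM symL S SE => [|k] L linL LM symL S SE.
    move=> s v; congr S; apply/funext => i /=.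
    by congr v; rewrite [LHS]ord1 [RHS]ord1.
  apply: symmetric_fcons => [u s v|u w v]; rewrite !SE.
    by have [_ sL _] := SymP (L u); exact: sL.
  by rewrite -!contrE symL.
- exists M => v; rewrite -(fconsK v) SE prod_fcons mulrA.
  apply: le_trans (Sym_norm_prod _ _) _.
  by rewrite ler_wpM2r ?prodr_ge0// fcons0.
Qed.

Definition uncurry k (L : G -> Sym k G E) : Sym k.+1 G E :=
  xget 0 [set S | forall u, contr u S = L u].

Lemma contr_uncurry k (L : G -> Sym k G E) M : linear L ->
  (forall u, `|L u| <= M * `|u|) -> swap_compatible L ->
  forall u, contr u (uncurry L) = L u.
Proof.
move=> linL LM symL; have [S SL] := uncurry_exists linL LM symL.
exact: (@xgetPex _ 0 [set S | forall u, contr u S = L u] (ex_intro _ S SL)).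
Qed.

Lemma Sym_const_lin : linear (@Sym_const R G E).
Proof. by move=> a c d; apply: Sym_inj. Qed.
HB.instance Definition _ :=
  GRing.isLinear.Build R E (Sym 0 G E) _ (@Sym_const R G E) Sym_const_lin.

Lemma Sym_constB c d : @Sym_const R G E (c - d) = Sym_const c - Sym_const d.
Proof. by apply: Sym_inj. Qed.

Lemma norm_Sym_const c : `|@Sym_const R G E c| = `|c|.
Proof.
apply/eqP; rewrite eq_le; apply/andP; split.
  by apply: Sym_norm_le_prod => // v; rewrite big_ord0 mulr1.
by have := Sym_norm_ge (@Sym_const R G E c) (v := fun=> 0); apply => -[].
Qed.

Lemma Sym_constK (S : Sym 0 G E) v : Sym_const (S v) = S.
Proof.
by apply: Sym_inj => w /=; congr (Sym_fun S _); apply/funext => -[].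
Qed.

End Contraction.

(** * Derivatives of maps defined on an open set *)

Lemma frechetP {R : realType} {V W : normedModType R} (f : V -> W) (x : V)
    (L : {linear V -> W}) : continuous L ->
  (differentiable f x /\ 'd f x = L :> (V -> W)) <->
  (forall e, 0 < e -> \forall z \near x,
    `|f z - f x - L (z - x)| <= e * `|z - x|).
Proof.
move=> Lc; split=> [[/diff_locally + dL]|H].
  rewrite dL => /eqaddoP H e e0; have {}H := H e e0.
  apply/nbhs0P; apply: filterS H => h /=.
  by rewrite !fctE /= [h + x]addrC [x + h - x]addrC addKr opprD addrA.
have fo : f \o shift x = cst (f x) + L +o_ 0 id.
  apply/eqaddoP => e e0; have /nbhs0P := H e e0; apply: filterS => h /=.
  by rewrite !fctE /= [h + x]addrC [x + h - x]addrC addKr opprD addrA.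
have dL := diff_unique Lc fo; split=> //.
by apply/diff_locallyP; rewrite dL.
Qed.

Section Derivatives.
Context {R : realType} {G E : normedModType R} {X : set G}.
Hypothesis Xo : open X.

Lemma near_val (x : X) (P : G -> Prop) :
  (\forall z \near val x, P z) -> \forall z \near x, P (val z).
Proof.
move=> /nbhs_ballP[d /= d0 dP]; apply/near_subtypeP; exists d => // z zx.
by apply: dP; rewrite -ball_normE /= distrC.
Qed.

Lemma near_val_inv (x : X) (P : G -> Prop) :
  (\forall z \near x, P (val z)) -> \forall z \near val x, P z.
Proof.
move=> /near_subtypeP[d d0 dP]; have [r r0 rX] := open_ball_sub Xo x.
apply/nbhs_ballP; exists (Num.min d r) => /=; first by rewrite lt_min d0.
move=> z; rewrite -ball_normE /= distrC lt_min => /andP[zd zr].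
have Xz : z \in X by rewrite inE; exact: rX.
exact: (dP (Sub z Xz)).
Qed.

Lemma valL_val (W : Type) (w : W) (g : X -> W) (x : X) : valL_ w g (val x) = g x.
Proof. by rewrite /valL_ oinv_set_val /= valK. Qed.

(** On the open set X the extension of g by 0 does not affect differentiability, which is
    thus a condition on g near x. *)
Lemma is_Sym_derivativeP k (g : X -> Sym k G E) (x : X) (L : Sym k.+1 G E) :
  is_Sym_derivative g x L <->
  forall e, 0 < e -> \forall z \near x,
    `|g z - g x - contr (val z - val x) L| <= e * `|val z - val x|.
Proof.
have Lc : continuous (contrl L).
  apply/linear_bounded_continuous.
  apply/ex_bound; exists `|L|; apply/nbhs_ballP; exists 1 => //= u.
  rewrite -ball_normE /= sub0r normrN => u1.
  by apply: le_trans (norm_contr _ _) _; rewrite ler_piMr// ltW.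
split=> [[dg gL] e e0|H].
  have dE : 'd (valL_ 0 g) (val x) = contrl L :> (G -> Sym k G E).
    by apply/funext => u; apply: Sym_inj => v; rewrite gL.
  have /(_ e e0)/near_val := (frechetP _ _ Lc).1 (conj dg dE).
  by apply: filterS => z; rewrite !valL_val.
have [] : differentiable (valL_ 0 g) (val x) /\
          'd (valL_ 0 g) (val x) = contrl L :> (G -> Sym k G E).
  apply/(frechetP _ _ Lc) => e e0; apply: near_val_inv.
  by apply: filterS (H e e0) => z; rewrite !valL_val.
by move=> dg dE; split=> // u v; rewrite dE.
Qed.

Lemma Sym_derivative_lip k (g : X -> Sym k G E) (x : X) (L : Sym k.+1 G E) :
  is_Sym_derivative g x L -> forall e, 0 < e ->
  \forall z \near x, `|g z - g x| <= (`|L| + e) * `|val z - val x|.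
Proof.
move=> /is_Sym_derivativeP dg e e0; apply: filterS (dg e e0) => z dz.
rewrite -(subrK (contr (val z - val x) L) (g z - g x)) addrC mulrDl.
by rewrite (le_trans (ler_normD _ _))// lerD// norm_contr.
Qed.

Lemma continuous_subtypeP (W : normedModType R) (g : X -> W) (x : X) :
  {for x, continuous g} <->
  forall e, 0 < e -> \forall z \near x, `|g z - g x| <= e.
Proof.
split=> [/(@cvgrPdist_le _ _ _ (nbhs x) _ g) H e e0|H].
  by apply: filterS (H e e0) => z; rewrite distrC.
by apply/(@cvgrPdist_le _ _ _ (nbhs x) _ g) => e e0; apply: filterS (H e e0) => z; rewrite distrC.
Qed.

Lemma near_val_lt (x : X) (d : R) : 0 < d ->
  \forall z \near x, `|val z - val x| < d.
Proof. by move=> d0; apply/near_subtypeP; exists d. Qed.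

Lemma Sym_derivative_continuous k (g : X -> Sym k G E) (x : X) (L : Sym k.+1 G E) :
  is_Sym_derivative g x L -> {for x, continuous g}.
Proof.
move=> dg; apply/continuous_subtypeP => e e0.
have c0 : 0 < `|L| + 1 by rewrite ltr_wpDl.
apply: filterS2 (Sym_derivative_lip dg ltr01) (near_val_lt x (divr_gt0 e0 c0)).
move=> z /le_trans + zx; apply.
by rewrite mulrC -ler_pdivlMr// ltW.
Qed.

Lemma Sym_derivative_near_eq k (g g' : X -> Sym k G E) (x : X) L :
  (\forall z \near x, g z = g' z) ->
  is_Sym_derivative g x L -> is_Sym_derivative g' x L.
Proof.
move=> gg' /is_Sym_derivativeP dg; apply/is_Sym_derivativeP => e e0.
have gx := nbhs_singleton gg'.
by apply: filterS2 gg' (dg e e0) => z <-; rewrite -gx.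
Qed.

Lemma near_Dn k (f g : X -> E) (x : X) : (\forall z \near x, f z = g z) ->
  \forall z \near x, Dn k f z = Dn k g z.
Proof.
move=> fg; elim: k => [|k IH]; first by apply: filterS fg => z /= ->.
apply: filterS (near_join IH) => z nz.
suff eqD : [set L | is_Sym_derivative (Dn k f) z L] =
         [set L | is_Sym_derivative (Dn k g) z L].
  by rewrite [LHS]/(xget 0 [set L | is_Sym_derivative (Dn k f) z L]) eqD.
apply/seteqP; split=> L /=; apply: Sym_derivative_near_eq => //.
by apply: filterS nz => w ->.
Qed.

Lemma Dn_near k (f g : X -> E) (x : X) : (\forall z \near x, f z = g z) ->
  Dn k f x = Dn k g x.
Proof. by move=> /(near_Dn k)/nbhs_singleton. Qed.

Lemma is_Cp_derivative p (f : X -> E) k x : is_Cp p f -> in_N p k.+1 ->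
  is_Sym_derivative (Dn k f) x (Dn k.+1 f x).
Proof. by move=> [df _] kp; have [L fL] := df k kp x; rewrite (DnSE fL). Qed.

(** To find all the derivatives of f, it is enough to guess them: a sequence of maps each of
    which is the derivative of the preceding one. *)
Lemma is_Cp_jets p (f : X -> E) (J : forall k, X -> Sym k G E) :
  (forall x, J 0%N x = Sym_const (f x)) ->
  (forall k, in_N p k.+1 -> forall x, is_Sym_derivative (J k) x (J k.+1 x)) ->
  (forall k, in_N p k -> continuous (J k)) ->
  is_Cp p f /\ forall k, in_N p k -> forall x, Dn k f x = J k x.
Proof.
move=> J0 dJ cJ.
have DJ k : in_N p k -> Dn k f = J k.
  elim: k => [_|k IH kp]; apply/funext => x; first by rewrite J0.
  by apply: DnSE; rewrite IH ?(in_NS kp)//; exact: dJ.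
split; last by move=> k kp x; rewrite DJ.
split=> k kp; last by rewrite DJ//; exact: cJ.
by move=> x; exists (J k.+1 x); rewrite DJ ?(in_NS kp)//; exact: dJ.
Qed.

Lemma is_Cp_near p (f : X -> E) :
  (forall x : X, exists2 g, is_Cp p g & \forall z \near x, f z = g z) -> is_Cp p f.
Proof.
move=> H; split=> k kp x; have [g [dg cg] fg] := H x.
  have [L gL] := dg k kp x; exists L.
  apply: Sym_derivative_near_eq gL; apply: near_Dn.
  by apply: filterS fg => z ->.
have Dfg := near_Dn k fg; have Dfx := nbhs_singleton Dfg; apply/continuous_subtypeP => e e0.
have /continuous_subtypeP/(_ e e0) := cg k kp x.
by apply: filterS2 Dfg => z ->; rewrite -Dfx.
Qed.

(** Apply the mean value inequality to D^k f minus a linear map, whose derivative is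
    D^(k+1) f - L. *)
Lemma Dn_mean_value p (f : X -> E) k (L : Sym k.+1 G E) M (a b : X) :
  is_Cp p f -> in_N p k.+1 ->
  (forall t, 0 <= t <= 1 -> X (val a + t *: (val b - val a))) ->
  (forall (z : X) t, 0 <= t <= 1 -> val z = val a + t *: (val b - val a) ->
     `|Dn k.+1 f z - L| <= M) ->
  `|Dn k f b - Dn k f a - contr (val b - val a) L| <= M * `|val b - val a|.
Proof.
move=> fp kp abX DM.
pose g (z : X) : Sym k G E := Dn k f z - contr (val z) L.
have gB z w : g z - g w = Dn k f z - Dn k f w - contr (val z - val w) L.
  by rewrite /g contrBl; linear_combination R.
rewrite -gB; apply: mean_value_segment => // z t t01 zt e e0.
have /is_Sym_derivativeP/(_ e e0) := is_Cp_derivative z fp kp.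
apply: filterS => z' dz; rewrite gB.
have -> : Dn k f z' - Dn k f z - contr (val z' - val z) L =
    (Dn k f z' - Dn k f z - contr (val z' - val z) (Dn k.+1 f z)) +
    contr (val z' - val z) (Dn k.+1 f z - L).
  by rewrite contrBr; linear_combination R.
rewrite addrC mulrDl (le_trans (ler_normD _ _))// lerD//.
by apply: le_trans (norm_contr _ _) _; rewrite ler_wpM2r// (DM z t).
Qed.

(** Integrate the bound on D^m f from y, one order at a time: each lower derivative
    vanishes at y and inherits one more factor |z - y|. *)
Lemma Dn_flat_bound p (f : X -> E) (m : nat) (e : R) (c : G) (r : R) (y : X) :
  is_Cp p f -> in_N p m -> (forall z, `|z - c| < r -> X z) ->
  `|val y - c| < r ->
  (forall j, (j < m)%N -> Dn j f y = 0) ->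
  (forall z : X, `|val z - c| < r -> `|Dn m f z| <= e) ->
  forall i j (z : X), (i + j)%N = m -> `|val z - c| < r ->
    `|Dn j f z| <= e * `|val z - val y| ^+ i.
Proof.
move=> fp mp rX yr fy fe; elim=> [j z jm zr|i IH j z ijm zr].
  by rewrite expr0 mulr1 -[j]add0n jm fe.
have jm : (j < m)%N by rewrite -ijm addSn ltnS leq_addl.
have jp : in_N p j.+1.
  by case: p {fp} mp => [p|//]; rewrite /in_N /=; exact: leq_trans.
have seg t : 0 <= t <= 1 -> `|val y + t *: (val z - val y) - c| < r.
  exact: segment_ball.
have := @Dn_mean_value p f j 0 (e * `|val z - val y| ^+ i) y z fp jp.
rewrite contr0r subr0 (fy _ jm) subr0 -mulrA -exprSr; apply.
  by move=> t t01; apply: rX; exact: seg.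
move=> w t t01 wt; rewrite subr0.
have wr : `|val w - c| < r by rewrite wt seg.
have e0 : 0 <= e by apply: le_trans (fe y yr).
apply: le_trans (IH j.+1 w _ wr) _; first by rewrite addnS -addSn.
rewrite ler_wpM2l// lerXn2r ?nnegrE// wt addrC addKr normrZ.
by case/andP: t01 => t0 t1; rewrite ger0_norm// ler_piMl.
Qed.

End Derivatives.

(** * The product rule *)

Lemma in_N_le (p : smooth_order) (i k : nat) :
  in_N p k -> (i <= k)%N -> in_N p i.
Proof. by case: p => [m|//]; rewrite /in_N /= => km ik; exact: leq_trans km. Qed.

Lemma near_all_lt (T : Type) (F : set_system T) (n : nat) (P : nat -> T -> Prop)
    {FF : Filter F} : (forall i, (i < n)%N -> \forall z \near F, P i z) ->
  \forall z \near F, forall i, (i < n)%N -> P i z.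
Proof.
elim: n => [_|n IH nP]; first exact: nearW.
have {}IH := IH (fun i lt => nP i (ltnW lt)).
apply: filterS2 IH (nP n (ltnSn n)) => z Pi Pn i.
by rewrite ltnS leq_eqVlt => /predU1P[->//|]; exact: Pi.
Qed.

Section Leibniz.
Context {R : realType} {G E : normedModType R}.
Local Notation jet E := (forall i, Sym i G E).

Definition contr_jet {W : normedModType R} (u : G) (a : jet W) : jet W :=
  fun i => contr u (a i.+1).

(** The n-th derivative of the product of a scalar function with jet a and a function with
    jet b: differentiating once more in the direction u replaces either a or b by its
    contraction with u. *)
Fixpoint leib (n : nat) (a : jet R^o) (b : jet E) : Sym n G E :=
  match n with
  | 0 => Sym_const ((a 0%N (fun=> 0) : R) *: b 0%N (fun=> 0))
  | n'.+1 => uncurry (fun u => leib n' (contr_jet u a) b + leib n' a (contr_jet u b))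
  end.

Let leib_linl n := forall c (a a' a'' : jet R^o) (b : jet E),
  (forall i, (i <= n)%N -> a'' i = c *: a i + a' i) ->
  leib n a'' b = c *: leib n a b + leib n a' b.
Let leib_linr n := forall c (a : jet R^o) (b b' b'' : jet E),
  (forall i, (i <= n)%N -> b'' i = c *: b i + b' i) ->
  leib n a b'' = c *: leib n a b + leib n a b'.
Let leib_bound n := forall al be la (a : jet R^o) (b : jet E),
  0 <= al -> 0 <= be -> 0 <= la ->
  (forall i, (i <= n)%N -> `|a i| <= al * la ^+ i) ->
  (forall i, (i <= n)%N -> `|b i| <= be * la ^+ i) ->
  `|leib n a b| <= 2 ^+ n * (al * be) * la ^+ n.
Let leib_contr n := forall u (a : jet R^o) (b : jet E),
  contr u (leib n.+1 a b) = leib n (contr_jet u a) b + leib n a (contr_jet u b).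

Let jet_sum_ge (W : normedModType R) (a : jet W) n i : (i <= n)%N ->
  `|a i| <= \sum_(j < n.+1) `|a j|.
Proof.
by rewrite -ltnS => lt; rewrite (bigD1 (Ordinal lt))//= lerDl sumr_ge0.
Qed.

(** Contracting twice gives the four ways to distribute u and w between a and b, which is
    symmetric in u and w since the contractions of a jet commute. *)
Let leib_step n : leib_linl n -> leib_linr n -> leib_bound n ->
  (if n is n'.+1 then leib_contr n' else True) -> leib_contr n.
Proof.
move=> ll lr bd ct u a b /=.
pose A := \sum_(j < n.+2) `|a j|; pose B := \sum_(j < n.+2) `|b j|.
have A0 : 0 <= A by rewrite sumr_ge0.
have B0 : 0 <= B by rewrite sumr_ge0.
apply: (@contr_uncurry _ _ _ _ _ (2 ^+ n * (A * B) * 2)).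
- move=> c v w.
  rewrite (ll c (contr_jet v a) (contr_jet w a)); last first.
    by move=> i _; exact: contrPl.
  rewrite (lr c a (contr_jet v b) (contr_jet w b) (contr_jet (c *: v + w) b)); last first.
    by move=> i _; exact: contrPl.
  by linear_combination R.
- move=> v.
  have -> : 2 ^+ n * (A * B) * 2 * `|v| =
    2 ^+ n * (A * `|v| * B) + 2 ^+ n * (A * (B * `|v|)) by ring.
  apply: le_trans (ler_normD _ _) _; apply: lerD.
    have := @bd (A * `|v|) B 1 (contr_jet v a) b.
    rewrite expr1n mulr1; apply=> //.
    + by rewrite mulr_ge0.
    + move=> i iN; rewrite expr1n mulr1; apply: le_trans (norm_contr _ _) _.
      by rewrite ler_wpM2r// jet_sum_ge.
    + by move=> i iN; rewrite expr1n mulr1; apply: jet_sum_ge; exact: leqW.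
  have := @bd A (B * `|v|) 1 a (contr_jet v b).
  rewrite expr1n mulr1; apply=> //.
  + by rewrite mulr_ge0.
  + by move=> i iN; rewrite expr1n mulr1; apply: jet_sum_ge; exact: leqW.
  + move=> i iN; rewrite expr1n mulr1; apply: le_trans (norm_contr _ _) _.
    by rewrite ler_wpM2r// jet_sum_ge.
- case: n ll lr bd ct @A @B A0 B0 => [//|n] ll lr bd ct _ _ _ _ v w /=.
  rewrite !contrDr -![uncurry _]/(leib n.+1 _ _) !ct.
  have cc (W : normedModType R) (c : jet W) :
      contr_jet v (contr_jet w c) = contr_jet w (contr_jet v c).
    by apply: functional_extensionality_dep => i; exact: contrC.
  by rewrite !cc; linear_combination R.
Qed.

(** The four properties are proved together: uncurry in the definition of the order n + 1 is
    meaningful only once linearity, boundedness and symmetry are known at order n. *)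
Lemma leibP n : [/\ leib_linl n, leib_linr n, leib_bound n & leib_contr n].
Proof.
elim: n => [|n [ll lr bd ct]].
  have l0 : leib_linl 0.
    move=> c a a' a'' b aE; rewrite /= aE// SymE.
    by rewrite scalerDl -scalerA linearP.
  have r0 : leib_linr 0.
    move=> c a b b' b'' bE; rewrite /= bE// SymE.
    by rewrite scalerDr scalerA mulrC -scalerA linearP.
  have b0 : leib_bound 0.
    move=> al be la a b al0 be0 la0 /(_ 0%N) + /(_ 0%N).
    rewrite !expr0 mul1r !mulr1 => aal bbe; rewrite /= norm_Sym_const normrZ.
    apply: ler_pM => //.
      by apply: le_trans (aal _) => //; apply: Sym_norm_ge => -[].
    by apply: le_trans (bbe _) => //; apply: Sym_norm_ge => -[].
  by split=> //; exact: leib_step.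
have ll' : leib_linl n.+1.
  move=> c a a' a'' b aE; apply: eq_contr => u.
  rewrite contrPr !ct.
  rewrite (ll c (contr_jet u a) (contr_jet u a') (contr_jet u a'')).
    rewrite (ll c a a' a''); first by linear_combination R.
    by move=> i ilt; apply: aE; exact: leqW.
  by move=> i ilt; rewrite /contr_jet aE// contrPr.
have lr' : leib_linr n.+1.
  move=> c a b b' b'' bE; apply: eq_contr => u.
  rewrite contrPr !ct.
  rewrite (lr c _ (contr_jet u b) (contr_jet u b') (contr_jet u b'')).
    rewrite (lr c _ b b' b''); first by linear_combination R.
    by move=> i ilt; apply: bE; exact: leqW.
  by move=> i ilt; rewrite /contr_jet bE// contrPr.
have bd' : leib_bound n.+1.
  move=> al be la a b al0 be0 la0 aal bbe.
  apply: norm_le_contr => [|u]; first by rewrite !mulr_ge0 ?exprn_ge0.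
  rewrite ct; apply: le_trans (ler_normD _ _) _.
  have -> : 2 ^+ n.+1 * (al * be) * la ^+ n.+1 * `|u| =
    2 ^+ n * (al * la * `|u| * be) * la ^+ n +
    2 ^+ n * (al * (be * la * `|u|)) * la ^+ n.
    by rewrite !exprS; ring.
  have bc (W : normedModType R) (c : jet W) ga :
      (forall i, (i <= n.+1)%N -> `|c i| <= ga * la ^+ i) ->
      forall i, (i <= n)%N -> `|contr_jet u c i| <= ga * la * `|u| * la ^+ i.
    move=> cga i ilt; apply: le_trans (norm_contr _ _) _.
    by rewrite mulrAC ler_wpM2r// -mulrA -exprS cga.
  apply: lerD; apply: bd => //; try by rewrite !mulr_ge0.
  - exact: bc.
  - by move=> i ilt; rewrite bbe// leqW.
  - by move=> i ilt; rewrite aal// leqW.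
  - exact: bc.
by split=> //; exact: leib_step.
Qed.

End Leibniz.

Section LeibnizCalculus.
Context {R : realType} {G E : normedModType R}.
Local Notation jet E := (forall i, Sym i G E).

Lemma leibBl n (a a' : jet R^o) (b : jet E) :
  leib n (fun i => a i - a' i) b = leib n a b - leib n a' b.
Proof.
have [ll _ _ _] := leibP (E := E) (G := G) n.
rewrite (ll (-1) a' a (fun i => a i - a' i)); first by linear_combination R.
by move=> i _; linear_combination R.
Qed.

Lemma leibBr n (a : jet R^o) (b b' : jet E) :
  leib n a (fun i => b i - b' i) = leib n a b - leib n a b'.
Proof.
have [_ lr _ _] := leibP (E := E) (G := G) n.
rewrite (lr (-1) a b' b (fun i => b i - b' i)); first by linear_combination R.
by move=> i _; linear_combination R.
Qed.

Lemma contr_leib n u (a : jet R^o) (b : jet E) :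
  contr u (leib n.+1 a b) = leib n (contr_jet u a) b + leib n a (contr_jet u b).
Proof. by have [_ _ _] := leibP (E := E) (G := G) n. Qed.

Lemma norm_leib n al be la (a : jet R^o) (b : jet E) :
  0 <= al -> 0 <= be -> 0 <= la ->
  (forall i, (i <= n)%N -> `|a i| <= al * la ^+ i) ->
  (forall i, (i <= n)%N -> `|b i| <= be * la ^+ i) ->
  `|leib n a b| <= 2 ^+ n * (al * be) * la ^+ n.
Proof. by have [_ _ bd _] := leibP (E := E) (G := G) n; exact: bd. Qed.

Lemma norm_leib1 n al be (a : jet R^o) (b : jet E) :
  0 <= al -> 0 <= be ->
  (forall i, (i <= n)%N -> `|a i| <= al) ->
  (forall i, (i <= n)%N -> `|b i| <= be) ->
  `|leib n a b| <= 2 ^+ n * (al * be).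
Proof.
move=> al0 be0 aal bbe; have := @norm_leib n al be 1 a b al0 be0 ler01.
rewrite expr1n mulr1; apply=> i iN; rewrite expr1n mulr1; [exact: aal|exact: bbe].
Qed.

Lemma jet_bounded (W : normedModType R) (a : jet W) n :
  exists2 A, 0 <= A & forall i, (i <= n)%N -> `|a i| <= A.
Proof.
exists (\sum_(j < n.+1) `|a j|); first by rewrite sumr_ge0.
move=> i; rewrite -ltnS => lt.
by rewrite (bigD1 (Ordinal lt))//= lerDl sumr_ge0.
Qed.

Context {X : set G}.
Hypothesis Xo : open X.

Lemma leib_continuous n (a : forall i, X -> Sym i G R^o)
    (b : forall i, X -> Sym i G E) (x : X) :
  (forall i, (i <= n)%N -> {for x, continuous (a i)}) ->
  (forall i, (i <= n)%N -> {for x, continuous (b i)}) ->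
  {for x, continuous (fun z => leib n (a ^~ z) (b ^~ z))}.
Proof.
move=> ca cb; apply/continuous_subtypeP => e e0.
have [A A0 aA] := jet_bounded (a ^~ x) n.
have [B B0 bB] := jet_bounded (b ^~ x) n.
pose C := 2 ^+ n * (A + B + 1).
have C0 : 0 < C by rewrite mulr_gt0 ?exprn_gt0 ?ltr_wpDl ?addr_ge0.
pose h := Num.min 1 (e / C).
have h0 : 0 < h by rewrite lt_min ltr01 divr_gt0.
have h1 : h <= 1 by rewrite ge_min lexx.
have hC : C * h <= e by rewrite mulrC -ler_pdivlMr// ge_min lexx orbT.
have near_a : \forall z \near x, forall i, (i < n.+1)%N -> `|a i z - a i x| <= h.
  by apply: (@near_all_lt _ (nbhs x)) => i ilt; exact: ((continuous_subtypeP _ _).1 (ca i ilt) h h0).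
have near_b : \forall z \near x, forall i, (i < n.+1)%N -> `|b i z - b i x| <= h.
  by apply: (@near_all_lt _ (nbhs x)) => i ilt; exact: ((continuous_subtypeP _ _).1 (cb i ilt) h h0).
apply: filterS2 near_a near_b => z az bz.
pose da i := a i z - a i x; pose db i := b i z - b i x.
have -> : leib n (a ^~ z) (b ^~ z) - leib n (a ^~ x) (b ^~ x) =
    leib n da (b ^~ x) + leib n (a ^~ x) db + leib n da db.
  by rewrite !leibBl !leibBr; linear_combination R.
apply: le_trans hC.
have -> : C * h = 2 ^+ n * (h * B) + 2 ^+ n * (A * h) + 2 ^+ n * (h * 1).
  by rewrite /C; ring.
apply: le_trans (ler_normD _ _) _; apply: lerD.
  apply: le_trans (ler_normD _ _) _; apply: lerD.
    by apply: norm_leib1 => //; first exact: ltW.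
  by apply: norm_leib1 => //; first exact: ltW.
apply: norm_leib1 => //; [exact: ltW|move=> i iN].
exact: le_trans (bz i iN) h1.
Qed.

(** Expand by bilinearity in the increments Da and Db; the term in both increments is of
    second order. *)
Lemma leib_derivative n (a : forall i, X -> Sym i G R^o)
    (b : forall i, X -> Sym i G E) (x : X) :
  (forall i, (i <= n)%N -> is_Sym_derivative (a i) x (a i.+1 x)) ->
  (forall i, (i <= n)%N -> is_Sym_derivative (b i) x (b i.+1 x)) ->
  is_Sym_derivative (fun z => leib n (a ^~ z) (b ^~ z)) x
    (leib n.+1 (a ^~ x) (b ^~ x)).
Proof.
move=> da db; apply/(is_Sym_derivativeP Xo) => e e0.
have [A A0 aA] := jet_bounded (a ^~ x) n.+1.
have [B B0 bB] := jet_bounded (b ^~ x) n.+1.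
pose C := 2 ^+ n * (A + B + (A + 1) * (B + 1)).
have C0 : 0 < C by rewrite mulr_gt0 ?exprn_gt0 ?ltr_wpDl ?addr_ge0// mulr_gt0// ltr_wpDl.
pose h := e / C.
have h0 : 0 < h by rewrite divr_gt0.
have hC : C * h = e by rewrite mulrC divfK// gt_eqF.
have near_a : \forall z \near x, forall i, (i < n.+1)%N ->
    `|a i z - a i x - contr (val z - val x) (a i.+1 x)| <= h * `|val z - val x|.
  by apply: (@near_all_lt _ (nbhs x)) => i ilt; exact: ((is_Sym_derivativeP Xo _ _ _).1 (da i ilt)).
have near_b : \forall z \near x, forall i, (i < n.+1)%N ->
    `|b i z - b i x - contr (val z - val x) (b i.+1 x)| <= h * `|val z - val x|.
  by apply: (@near_all_lt _ (nbhs x)) => i ilt; exact: ((is_Sym_derivativeP Xo _ _ _).1 (db i ilt)).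
have near_a1 : \forall z \near x, forall i, (i < n.+1)%N ->
    `|a i z - a i x| <= (A + 1) * `|val z - val x|.
  apply: (@near_all_lt _ (nbhs x)) => i ilt.
  apply: filterS (Sym_derivative_lip Xo (da i ilt) ltr01) => z /le_trans; apply.
  by rewrite ler_wpM2r// lerD2r aA.
have near_b1 : \forall z \near x, forall i, (i < n.+1)%N ->
    `|b i z - b i x| <= (B + 1) * `|val z - val x|.
  apply: (@near_all_lt _ (nbhs x)) => i ilt.
  apply: filterS (Sym_derivative_lip Xo (db i ilt) ltr01) => z /le_trans; apply.
  by rewrite ler_wpM2r// lerD2r bB.
apply: filterS3 near_a near_b (filterI (near_val_lt x h0) (filterI near_a1 near_b1)).
move=> z az bz [zx [az1 bz1]].
set t := `|val z - val x| in zx *.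
have t0 : 0 <= t by rewrite /t.
pose Da i := a i z - a i x; pose Db i := b i z - b i x.
pose ha := contr_jet (val z - val x) (a ^~ x).
pose hb := contr_jet (val z - val x) (b ^~ x).
have -> : leib n (a ^~ z) (b ^~ z) - leib n (a ^~ x) (b ^~ x) -
      contr (val z - val x) (leib n.+1 (a ^~ x) (b ^~ x)) =
    leib n (fun i => Da i - ha i) (b ^~ x) + leib n (a ^~ x) (fun i => Db i - hb i) +
    leib n Da Db.
  by rewrite contr_leib !leibBl !leibBr /ha /hb; linear_combination R.
apply: (@le_trans _ _ (2 ^+ n * (h * t * B) + 2 ^+ n * (A * (h * t)) +
    2 ^+ n * ((A + 1) * t * ((B + 1) * t)))).
  apply: le_trans (ler_normD _ _) _; apply: lerD.
    apply: le_trans (ler_normD _ _) _; apply: lerD.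
      apply: norm_leib1 => //; first by rewrite mulr_ge0// ltW.
      by move=> i iN; apply: bB; exact: leqW.
    apply: norm_leib1 => //; first by rewrite mulr_ge0// ltW.
      by move=> i iN; apply: aA; exact: leqW.
  by apply: norm_leib1; rewrite ?mulr_ge0 ?addr_ge0.
have -> : e * t = 2 ^+ n * (h * t * B) + 2 ^+ n * (A * (h * t)) +
    2 ^+ n * ((A + 1) * t * ((B + 1) * h)) by rewrite -hC /C; ring.
by rewrite lerD2l ler_wpM2l ?exprn_ge0// ler_wpM2l ?mulr_ge0 ?addr_ge0//
  ler_wpM2l ?addr_ge0// ltW.
Qed.

Lemma is_Cp_scale p (phi : X -> R^o) (f : X -> E) : is_Cp p phi -> is_Cp p f ->
  is_Cp p (fun x => (phi x : R) *: f x) /\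
  forall k, in_N p k -> forall x, Dn k (fun x => (phi x : R) *: f x) x =
    leib k (fun i => Dn i phi x) (fun i => Dn i f x).
Proof.
move=> pp fp.
apply: is_Cp_jets => [x|k kp x|k kp x].
- by [].
- apply: leib_derivative => i ik.
    exact: (is_Cp_derivative x pp (in_N_le kp (_ : (i < k.+1)%N))).
  exact: (is_Cp_derivative x fp (in_N_le kp (_ : (i < k.+1)%N))).
- apply: leib_continuous => i ik.
    by have [_ c] := pp; apply: c; exact: in_N_le kp ik.
  by have [_ c] := fp; apply: c; exact: in_N_le kp ik.
Qed.

End LeibnizCalculus.

(** * Dilations and homogeneous polynomials *)

Section Dilation.
Context {R : realType} {G W : normedModType R} {X : set G}.
Hypothesis Xo : open X.

Definition whole_pt (w : G) : [set: G] := Sub w (mem_set (I : [set: G] w)).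

Lemma is_Cp_dilate p (g : [set: G] -> W) (la : R) (x0 : G) : is_Cp p g ->
  is_Cp p (fun z : X => g (whole_pt (la *: (val z - x0)))) /\
  forall k, in_N p k -> forall z : X,
    Dn k (fun z : X => g (whole_pt (la *: (val z - x0)))) z =
    la ^+ k *: Dn k g (whole_pt (la *: (val z - x0))).
Proof.
move=> gp; pose m z := whole_pt (la *: (z - x0)).
have mB z w : val (m w) - val (m z) = la *: (w - z).
  by rewrite /=; linear_combination R.
have near_m (z : X) (P : [set: G] -> Prop) :
    (\forall w \near m (val z), P w) -> \forall w \near z, P (m (val w)).
  move=> /near_subtypeP[d d0 dP].
  have l1 : 0 < `|la| + 1 by rewrite ltr_wpDl.
  apply: filterS (near_val_lt z (divr_gt0 d0 l1)) => w wz; apply: dP.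
  rewrite mB normrZ; apply: le_lt_trans (_ : (`|la| + 1) * `|val w - val z| < d).
    by rewrite ler_wpM2r// lerDl.
  by rewrite mulrC -ltr_pdivlMr.
apply: is_Cp_jets => [z|k kp z|k kp z].
- by rewrite expr0 scale1r.
- apply/(is_Sym_derivativeP Xo) => e e0.
  have l1 : 0 < `|la| ^+ k.+1 + 1 by rewrite ltr_wpDl ?exprn_ge0.
  have /(is_Sym_derivativeP openT)/(_ _ (divr_gt0 e0 l1)) :=
    is_Cp_derivative (m (val z)) gp kp.
  move=> /near_m; apply: filterS => w; rewrite mB => dw.
  have -> : la ^+ k *: Dn k g (m (val w)) - la ^+ k *: Dn k g (m (val z)) -
      contr (val w - val z) (la ^+ k.+1 *: Dn k.+1 g (m (val z))) =
    la ^+ k *: (Dn k g (m (val w)) - Dn k g (m (val z)) -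
      contr (la *: (val w - val z)) (Dn k.+1 g (m (val z)))).
    by rewrite contrZr contrZl exprSr; linear_combination R.
  rewrite normrZ normrX; apply: le_trans (ler_wpM2l _ dw) _; first exact: exprn_ge0.
  rewrite normrZ.
  have -> : `|la| ^+ k * (e / (`|la| ^+ k.+1 + 1) * (`|la| * `|val w - val z|)) =
    `|la| ^+ k.+1 / (`|la| ^+ k.+1 + 1) * (e * `|val w - val z|).
    by rewrite exprSr; ring.
  by rewrite ler_piMl ?mulr_ge0 ?(ltW e0)// ler_pdivrMr// mul1r lerDl.
- apply/continuous_subtypeP => e e0.
  have l1 : 0 < `|la| ^+ k + 1 by rewrite ltr_wpDl ?exprn_ge0.
  have [_ /(_ k kp)] := gp; move=> /(_ (m (val z))).
  move=> /continuous_subtypeP/(_ _ (divr_gt0 e0 l1))/near_m.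
  apply: filterS => w dw; rewrite -scalerBr normrZ normrX.
  apply: le_trans (ler_wpM2l _ dw) _; first exact: exprn_ge0.
  by rewrite mulrCA ler_piMr ?(ltW e0)// ler_pdivrMr// mul1r lerDl.
Qed.

End Dilation.

Section Monomials.
Context {R : realType} {G E : normedModType R}.

Definition diag k (S : Sym k G E) (w : G) : E := S (fun=> w).

Lemma diagS k (S : Sym k.+1 G E) w : diag S w = diag (contr w S) w.
Proof.
rewrite /diag contrE; congr (Sym_fun S _); apply/funext => i.
by case: (unliftP ord0 i) => [j|] ->; rewrite ?fconsS ?fcons0.
Qed.

Lemma diagD k (S T : Sym k G E) w : diag (S + T) w = diag S w + diag T w.
Proof. by []. Qed.

Lemma norm_diag k (S : Sym k G E) w : `|diag S w| <= `|S| * `|w| ^+ k.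
Proof.
apply: le_trans (Sym_norm_prod _ _) _.
by rewrite big_const_ord iter_mulr_1.
Qed.

(** The remainder is uniform in S, which allows the induction on the degree: contract S with
    w + u, and use the induction hypothesis for both contractions. *)
Lemma diag_taylor k (r : R) : 0 <= r -> exists2 C, 0 <= C &
  forall (S : Sym k.+1 G E) w u, `|w| <= r -> `|u| <= 1 ->
  `|diag S (w + u) - diag S w - k.+1%:R *: diag (contr u S) w| <=
    C * `|S| * `|u| ^+ 2.
Proof.
move=> r0; elim: k => [|k [C C0 IH]].
  exists 0 => // S w u _ _; rewrite !mul0r.
  suff -> : diag S (w + u) - diag S w - 1%:R *: diag (contr u S) w = 0.
    by rewrite normr0.
  have d0 v v' : diag (contr v S) v' = diag (contr v S) 0.
    by congr (Sym_fun (contr v S) _); apply/funext => -[].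
  rewrite !(diagS S) (d0 _ (w + u)) (d0 w) (d0 u w) contrDl diagD.
  by linear_combination R.
exists (C * r + C + k.+1%:R * r ^+ k).
  by rewrite !addr_ge0 ?mulr_ge0 ?exprn_ge0.
move=> S w u wr u1.
rewrite !(diagS S) contrDl diagD.
have := IH (contr w S) w u wr u1; have := IH (contr u S) w u wr u1.
rewrite [contr u (contr w S)]contrC -[diag (contr w (contr u S)) w]diagS.
set e2 := _ - _ - _ => e2C; set e1 := _ - _ - _ => e1C.
have -> : diag (contr w S) (w + u) + diag (contr u S) (w + u) - diag (contr w S) w -
    k.+2%:R *: diag (contr u S) w =
    e1 + e2 + k.+1%:R *: diag (contr u (contr u S)) w.
  rewrite /e1 /e2 -[k.+2]addn1 natrD.
  by linear_combination R.
have -> : (C * r + C + k.+1%:R * r ^+ k) * `|S| * `|u| ^+ 2 =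
  C * (`|S| * r) * `|u| ^+ 2 + C * (`|S| * 1) * `|u| ^+ 2 +
  k.+1%:R * (`|S| * `|u| * `|u| * r ^+ k) by ring.
apply: le_trans (ler_normD _ _) _; apply: lerD.
  apply: le_trans (ler_normD _ _) _; apply: lerD.
    apply: le_trans e1C _; rewrite ler_wpM2r ?exprn_ge0// ler_wpM2l//.
    by apply: le_trans (norm_contr _ _) _; rewrite ler_wpM2l.
  apply: le_trans e2C _; rewrite ler_wpM2r ?exprn_ge0// ler_wpM2l//.
  by apply: le_trans (norm_contr _ _) _; rewrite ler_wpM2l.
rewrite normrZ normr_nat ler_wpM2l//; apply: le_trans (norm_diag _ _) _.
apply: ler_pM; rewrite ?exprn_ge0//.
  apply: le_trans (norm_contr _ _) _; rewrite ler_wpM2r//.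
  exact: norm_contr.
by rewrite lerXn2r// nnegrE.
Qed.

(** The j-th derivative at w of the homogeneous polynomial S(w, ..., w) / k! *)
Fixpoint monomial_jet (j k : nat) : Sym k G E -> G -> Sym j G E :=
  match j with
  | 0 => fun S w => Sym_const (k`!%:R^-1 *: diag S w)
  | j'.+1 =>
    match k with
    | 0 => fun _ _ => 0
    | k'.+1 => fun S w => uncurry (fun u => monomial_jet j' (contr u S) w)
    end
  end.

Let mjet_lin j := forall k c (S T : Sym k G E) w,
  monomial_jet j (c *: S + T) w = c *: monomial_jet j S w + monomial_jet j T w.
Let mjet_bound j := forall k (S : Sym k G E) w, (j <= k)%N ->
  `|monomial_jet j S w| <= `|S| * `|w| ^+ (k - j).
Let mjet0 j := forall k (S : Sym k G E) w, (k < j)%N -> monomial_jet j S w = 0.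
Let mjet_contr j := forall k u (S : Sym k.+1 G E) w,
  contr u (monomial_jet j.+1 S w) = monomial_jet j (contr u S) w.

(** Here the condition for uncurry is that contractions of S commute. *)
Let mjet_step j : mjet_lin j -> mjet_bound j -> mjet0 j ->
  (if j is j'.+1 then mjet_contr j' else True) -> mjet_contr j.
Proof.
move=> l b z ct k u S w /=.
apply: (@contr_uncurry _ _ _ _ _ (`|S| * (if (j <= k)%N then `|w| ^+ (k - j) else 0))).
- by move=> c v v'; rewrite contrPl l.
- move=> v; case: leqP => jk.
    apply: le_trans (b _ _ _ jk) _.
    by rewrite [leRHS]mulrAC ler_wpM2r ?exprn_ge0// norm_contr.
  by rewrite z// normr0 mulr0 mul0r.
- case: j l b z ct => [//|j] l b z ct v v'.
  case: k S => [|k] S; first by rewrite /= !contr0r.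
  by rewrite -/(monomial_jet j.+1 _ _) !ct contrC.
Qed.

Lemma monomial_jetP j : [/\ mjet_lin j, mjet_bound j, mjet0 j & mjet_contr j].
Proof.
elim: j => [|j [l b z ct]].
  have l0 : mjet_lin 0.
    move=> k c S T w; rewrite /=.
have -> : (c *: (S : _ -> E) + (T : _ -> E)) (fun=> w) = c *: diag S w + diag T w.
      by [].
    by rewrite scalerDr scalerA mulrC -scalerA linearP.
  have b0 : mjet_bound 0.
    move=> k S w _; rewrite /= norm_Sym_const subn0 normrZ.
    apply: le_trans (norm_diag S w); rewrite ler_piMl// normfV normr_nat.
    by rewrite invf_le1 ?ltr0n ?fact_gt0// ler1n fact_gt0.
  by split=> //; exact: mjet_step.
have l' : mjet_lin j.+1.
  move=> [|k] c S T w; first by rewrite /= scaler0 addr0.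
  by apply: eq_contr => u; rewrite contrPr !ct contrPr l.
have b' : mjet_bound j.+1.
  move=> [//|k] S w jk; apply: norm_le_contr => [|u].
    by rewrite mulr_ge0 ?exprn_ge0.
  rewrite ct subSS mulrAC; apply: le_trans (b _ _ _ jk) _.
  by rewrite ler_wpM2r ?exprn_ge0// norm_contr.
have z' : mjet0 j.+1.
  move=> [//|k] S w jk; apply: eq_contr => u.
  by rewrite ct z// contr0r.
by split=> //; exact: mjet_step.
Qed.

Lemma contr_monomial_jet j k u (S : Sym k.+1 G E) w :
  contr u (monomial_jet j.+1 S w) = monomial_jet j (contr u S) w.
Proof. by have [_ _ _] := monomial_jetP j. Qed.

Lemma norm_monomial_jet j k (S : Sym k G E) w : (j <= k)%N ->
  `|monomial_jet j S w| <= `|S| * `|w| ^+ (k - j).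
Proof. by have [_ + _ _] := monomial_jetP j; exact. Qed.

Lemma monomial_jet_gt j k (S : Sym k G E) w : (k < j)%N -> monomial_jet j S w = 0.
Proof. by have [_ _ + _] := monomial_jetP j; exact. Qed.

Lemma monomial_jet_diag k (S : Sym k G E) : monomial_jet k S 0 = S.
Proof.
elim: k S => [|k IH] S.
  by rewrite /= fact0 invr1 scale1r Sym_constK.
by apply: eq_contr => u; rewrite contr_monomial_jet IH.
Qed.

Lemma monomial_jet_lt j k (S : Sym k G E) : (j < k)%N -> monomial_jet j S 0 = 0.
Proof.
move=> jk; apply/eqP; rewrite -normr_le0.
apply: le_trans (norm_monomial_jet S 0 (ltnW jk)) _.
by rewrite normr0 expr0n subn_eq0 leqNgt jk mulr0.
Qed.

(** The quadratic remainder shows that the jet of order j + 1 is the derivative of the jet of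
    order j. *)
Lemma monomial_jet_taylor j k (r : R) : 0 <= r -> exists2 C, 0 <= C &
  forall (S : Sym k G E) w u, `|w| <= r -> `|u| <= 1 ->
  `|monomial_jet j S (w + u) - monomial_jet j S w - contr u (monomial_jet j.+1 S w)| <=
    C * `|S| * `|u| ^+ 2.
Proof.
move=> r0; elim: j k => [|j IH] [|k].
- exists 0 => // S w u _ _; rewrite !mul0r /= contr0r subr0.
  have d0 v : diag S v = diag S 0 by congr (Sym_fun S _); apply/funext => -[].
  by rewrite (d0 w) (d0 (w + u)) subrr normr0.
- have [C C0 dC] := diag_taylor k r0; exists C => // S w u wr u1.
  rewrite contr_monomial_jet /=.
  set a := k.+1`!%:R^-1.
  have -> : k`!%:R^-1 = a * k.+1%:R :> R.
    by rewrite /a factS natrM invfM mulrAC mulVf ?mul1r// pnatr_eq0.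
  rewrite -!Sym_constB norm_Sym_const -[Sym_fun S (fcons u _)]/(diag (contr u S) w).
  have -> : a *: diag S (w + u) - a *: diag S w - (a * k.+1%:R) *: diag (contr u S) w =
    a *: (diag S (w + u) - diag S w - k.+1%:R *: diag (contr u S) w).
    by linear_combination R.
  rewrite normrZ; apply: le_trans (dC S w u wr u1); rewrite ler_piMl//.
  by rewrite /a normfV normr_nat invf_le1 ?ltr0n ?fact_gt0// ler1n fact_gt0.
- by exists 0 => // S w u _ _; rewrite /= contr0r !subr0 !mul0r normr0.
- have [C C0 dC] := IH k; exists C => // S w u wr u1.
  apply: norm_le_contr => [|v]; first by rewrite !mulr_ge0 ?exprn_ge0.
  rewrite !contrBr contrC !contr_monomial_jet.
  apply: le_trans (dC (contr v S) w u wr u1) _.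
  by rewrite [leRHS]mulrAC ler_wpM2r ?exprn_ge0// -mulrA ler_wpM2l// norm_contr.
Qed.

Definition monomial {X : set G} (x0 : G) k (S : Sym k G E) : X -> E :=
  fun z => k`!%:R^-1 *: diag S (val z - x0).

Lemma is_Cp_monomial {X : set G} p (x0 : G) k (S : Sym k G E) : open X ->
  is_Cp p (@monomial X x0 k S) /\
  forall j, in_N p j -> forall z : X,
    Dn j (@monomial X x0 k S) z = monomial_jet j S (val z - x0).
Proof.
move=> Xo; have der j (z : X) : is_Sym_derivative
    (fun z : X => monomial_jet j S (val z - x0)) z
    (monomial_jet j.+1 S (val z - x0)).
  apply/(is_Sym_derivativeP Xo) => e e0.
  have [C C0 dC] := @monomial_jet_taylor j k `|val z - x0| (normr_ge0 _).
  have C1 : 0 < C * `|S| + 1 by rewrite ltr_wpDl ?mulr_ge0.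
  pose d := Num.min 1 (e / (C * `|S| + 1)).
  have d0 : 0 < d by rewrite lt_min ltr01 divr_gt0.
  apply: filterS (near_val_lt z d0) => w; rewrite lt_min => /andP[w1 we].
  have := dC S (val z - x0) (val w - val z) (lexx _) (ltW w1).
  have -> : val z - x0 + (val w - val z) = val w - x0 by linear_combination R.
  move=> /le_trans; apply; rewrite expr2 mulrA ler_wpM2r//.
  apply: le_trans (_ : (C * `|S| + 1) * `|val w - val z| <= e).
    by rewrite ler_wpM2r// lerDl.
  by rewrite mulrC -ler_pdivlMr// ltW.
apply: is_Cp_jets => // k' kp z.
exact: (Sym_derivative_continuous Xo (der k' z)).
Qed.

End Monomials.

(** * The seminorms and the topology of C^p *)

Section Seminorms.
Context {R : realType} {G E : normedModType R} {X : set G} {p : smooth_order}.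
Implicit Types (f g : Cp X E p) (K : set X).

Lemma Cp_is f : is_Cp p f.
Proof. exact/Cp_predP/Cp_funP. Qed.

Lemma DnP f g (a : R) k x : in_N p k ->
  Dn k (a *: f + g : Cp X E p) x = a *: Dn k f x + Dn k g x.
Proof.
by move=> kp; rewrite -[LHS]/(Dn k (a *: (f : X -> E) + (g : X -> E)) x)
  (Dn_lin a (Cp_is f) (Cp_is g) kp).
Qed.

Lemma DnB f g k x : in_N p k ->
  Dn k (f - g : Cp X E p) x = Dn k f x - Dn k g x.
Proof.
move=> kp; have -> : f - g = (-1) *: g + f by linear_combination R.
by rewrite DnP//; linear_combination R.
Qed.

Lemma DnD f g k x : in_N p k ->
  Dn k (f + g : Cp X E p) x = Dn k f x + Dn k g x.
Proof. by move=> kp; rewrite -[f]scale1r DnP// !scale1r. Qed.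

Lemma Dn0 k x : Dn k (0 : Cp X E p) x = 0.
Proof. by rewrite -[LHS]/(Dn k (0 : X -> E) x) Dn_cst0. Qed.

Lemma DnZ f (a : R) k x : in_N p k ->
  Dn k (a *: f : Cp X E p) x = a *: Dn k f x.
Proof. by move=> kp; rewrite -[a *: f]addr0 DnP// Dn0 addr0. Qed.

Let bounded_Dn f K k : compact K -> in_N p k ->
  exists M, forall x, K x -> `|Dn k f x| <= M.
Proof.
move=> cK kp; have [_ /(_ k kp) cf] := Cp_is f.
have : compact (Dn k f @` K).
  apply: continuous_compact => //; exact: continuous_subspaceT.
move=> /compact_bounded[M [_ MK]]; exists (M + 1) => x Kx.
by apply: (MK (M + 1)); [rewrite ltrDl | exists x].
Qed.

Lemma rho_has_sup f K k : compact K -> in_N p k -> K !=set0 ->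
  has_sup [set \big[Num.max/0]_(j < k.+1) `|Dn j f x| | x in K].
Proof.
move=> cK kp [x Kx]; split; first by eexists; exists x.
suff [M HM] : exists M, forall j x, (j < k.+1)%N -> K x -> `|Dn j f x| <= M.
  exists (Num.max 0 M) => _ [y Ky <-]; apply: bigmax_le => [|j _].
    by rewrite le_max lexx.
  by rewrite le_max HM ?orbT.
have : (k.+1 <= k.+1)%N by [].
elim: {-2}k.+1 => [|n IH nk]; first by exists 0.
have [M HM] := IH (ltnW nk).
have [N HN] := @bounded_Dn f K n cK (in_N_le kp nk).
exists (Num.max M N) => j y; rewrite ltnS leq_eqVlt => /predU1P[->|jn] Ky.
  by rewrite le_max HN ?orbT.
by rewrite le_max HM.
Qed.

Lemma Dn_le_rho f K k j x : compact K -> in_N p k -> (j <= k)%N -> K x ->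
  `|Dn j f x| <= rho K k f.
Proof.
rewrite -ltnS => cK kp jk Kx.
apply: le_trans (_ : \big[Num.max/0]_(j < k.+1) `|Dn j f x| <= _).
  by have := le_bigmax 0 (fun j : 'I_k.+1 => `|Dn j f x|) (Ordinal jk).
apply: ub_le_sup; last by exists x.
by have [] := @rho_has_sup f K k cK kp (ex_intro _ x Kx).
Qed.

Lemma rho_le f K k M : 0 <= M ->
  (forall j x, (j <= k)%N -> K x -> `|Dn j f x| <= M) -> rho K k f <= M.
Proof.
move=> M0 fM; rewrite /rho; have [->|/set0P[x Kx]] := eqVneq K set0.
  by rewrite image_set0 sup0.
apply: ge_sup; first by eexists; exists x.
move=> _ [y Ky <-]; apply: bigmax_le => // j _; apply: fM => //.
by rewrite -ltnS.
Qed.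

Lemma rho_ge0 f K k : compact K -> in_N p k -> 0 <= rho K k f.
Proof.
move=> cK kp; have [->|/set0P[x Kx]] := eqVneq K set0.
  by rewrite /rho image_set0 sup0.
by apply: le_trans (@Dn_le_rho f K k 0 x cK kp _ Kx).
Qed.

Lemma rhoD f g K k : compact K -> in_N p k ->
  rho K k (f + g : Cp X E p) <= rho K k f + rho K k g.
Proof.
move=> cK kp; apply: rho_le => [|j x jk Kx]; first by rewrite addr_ge0// rho_ge0.
rewrite DnD ?(in_N_le kp)//; apply: le_trans (ler_normD _ _) _.
by rewrite lerD// Dn_le_rho.
Qed.

Lemma rhoZ f (a : R) K k : compact K -> in_N p k ->
  rho K k (a *: f : Cp X E p) <= `|a| * rho K k f.
Proof.
move=> cK kp; apply: rho_le => [|j x jk Kx]; first by rewrite mulr_ge0// rho_ge0.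
by rewrite DnZ ?(in_N_le kp)// normrZ ler_wpM2l// Dn_le_rho.
Qed.

Lemma rho_mono f K K' k k' : compact K' -> in_N p k' -> K `<=` K' -> (k <= k')%N ->
  rho K k f <= rho K' k' f.
Proof.
move=> cK' kp' KK' kk'; apply: rho_le => [|j x jk Kx]; first exact: rho_ge0.
by apply: Dn_le_rho => //; [exact: leq_trans kk'|exact: KK'].
Qed.

Lemma open_subbase (B : set (Cp X E p)) : @Cp_subbase R G X E p B -> open B.
Proof.
move=> sB; exists [set B] => [_ ->|].
  exists [fset B]%fset => [i|]; first by move=> /fset1P ->; exact: mem_set.
  by rewrite set_fset1 bigcap_set1.
by rewrite bigcup_set1.
Qed.

Lemma near_rho f K k e : compact K -> in_N p k -> 0 < e ->
  \forall g \near f, rho K k (g - f : Cp X E p) < e.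
Proof.
move=> cK kp e0; apply: (@open_nbhs_nbhs _ f [set g | rho K k (g - f : Cp X E p) < e]).
split; first by apply: open_subbase; exists f, K, k, e.
have r0 : rho K k (0 : Cp X E p) <= 0.
  by apply: (@rho_le 0 K k 0) => // j x jk Kx; rewrite Dn0 normr0.
by rewrite -(subrr f) in r0; exact: le_lt_trans e0.
Qed.

(** The seminorms rho are directed: a finite intersection of subbasic sets contains the ball
    of a single one. *)
Lemma open_rho (U : set (Cp X E p)) f : open U -> U f ->
  exists K k e, [/\ compact K, in_N p k, 0 < e &
    forall g, rho K k (g - f : Cp X E p) < e -> U g].
Proof.
move=> [D DU <-] [B DB Bf]; have [I sI eB] := DU _ DB.
suff [K [k [e [cK kp e0 HB]]]] : exists K k e, [/\ compact K, in_N p k, 0 < e &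
    forall g, rho K k (g - f : Cp X E p) < e -> B g].
  by exists K, k, e; split=> // g /HB Bg; exists B.
rewrite -eB in Bf *; have {}sI : forall C, C \in I -> @Cp_subbase R G X E p C.
  by move=> C /sI; rewrite inE.
have {Bf} : forall C, C \in I -> C f by move=> C CI; exact: Bf.
move=> {eB DB B DU D U} If.
suff [K [k [e [cK kp e0 HB]]]] : exists K k e, [/\ compact K, in_N p k, 0 < e &
    forall g, rho K k (g - f : Cp X E p) < e -> forall C, C \in enum_fset I -> C g].
  by exists K, k, e; split=> // g /HB Bg C CI; exact: Bg.
have {}sI : forall C, C \in enum_fset I -> @Cp_subbase R G X E p C by exact: sI.
have {}If : forall C, C \in enum_fset I -> C f by exact: If.
elim: (enum_fset I) sI If => [_ _|C s IH sI If].
  exists set0, 0%N, 1; split => //; first exact: compact0.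
  by case: (p).
have [C' C's|C' C's|K [k [e [cK kp e0 Hs]]]] := IH.
- by apply: sI; rewrite in_cons C's orbT.
- by apply: If; rewrite in_cons C's orbT.
have [f0 [K0 [k0 [e1 [cK0 kp0 e10 CE]]]]] := sI C (mem_head _ _).
have Cf := If C (mem_head _ _); rewrite CE /= in Cf.
exists (K `|` K0), (maxn k k0), (Num.min e (e1 - rho K0 k0 (f - f0 : Cp X E p))).
have mp : in_N p (maxn k k0) by rewrite /maxn; case: ifP.
have cU : compact (K `|` K0) by exact: compactU.
split => //; first by rewrite lt_min e0 subr_gt0.
move=> g; rewrite lt_min => /andP[g1 g2] C'; rewrite in_cons => /predU1P[->|].
  suff: rho K0 k0 (g - f0 : Cp X E p) < e1 by rewrite CE.
  have -> : g - f0 = (g - f) + (f - f0) by linear_combination R.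
  apply: le_lt_trans (rhoD _ _ cK0 kp0) _; rewrite -ltrBrDr.
  by apply: le_lt_trans g2; apply: rho_mono => //; exact: leq_maxr.
by apply: Hs; apply: le_lt_trans g1; apply: rho_mono => //; exact: leq_maxl.
Qed.

Lemma cvg_rho (F : set_system (Cp X E p)) f : Filter F ->
  (forall K k e, compact K -> in_N p k -> 0 < e ->
     \forall g \near F, rho K k (g - f : Cp X E p) < e) -> F --> f.
Proof.
move=> FF HF A; rewrite nbhsE => -[B [oB Bf] BA].
have [K [k [e [cK kp e0 HB]]]] := open_rho oB Bf.
by apply: filterS (HF K k e cK kp e0) => g /HB /BA.
Qed.

Lemma continuous_eval_Dn m x : in_N p m ->
  continuous (fun g : Cp X E p => Dn m g x).
Proof.
move=> mp f; apply/(@cvgrPdist_lt _ _ _ (nbhs f)) => e e0.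
have c1 : compact [set x] by exact: compact_set1.
apply: filterS (near_rho f c1 mp e0) => g; apply: le_lt_trans.
by rewrite distrC -DnB//; exact: Dn_le_rho.
Qed.

End Seminorms.

(** * The Arzela-Ascoli theorem in C^q *)

(** An ultrafilter that does not converge to y avoids a neighbourhood of y, hence lives on
    finitely many terms of the sequence. *)
Lemma compact_cvg_seq (T : topologicalType) (z : nat -> T) (y : T) :
  z @ \oo --> y -> compact ([set y] `|` range z).
Proof.
move=> zy; rewrite compact_ultra => U UU UK.
have [Uy|/existsNP[N]] := pselect (U --> y); first by exists y; split=> //=; left.
move=> /not_implyP[Ny UN]; have [n0 _ zN] := zy _ Ny.
have UNC : U (~` N) by have [|//] := in_ultra_setVsetC N UU.
have cI : compact (z @` `I_n0).
  by apply: finite_compact; apply: finite_image; exact: finite_II.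
have UI : U (z @` `I_n0).
  apply: filterS (filterI UK UNC) => _ [[->|[n _ <-]] Nz].
    by have := nbhs_singleton Ny.
  exists n => //=; rewrite ltnNge; apply/negP => n0n; apply: Nz; exact: zN.
have [x [[n _ <-] xU]] := cI U _ UI.
exists (z n); split; first by right; exists n.
by rewrite ultra_cvg_clusterE in xU.
Qed.

(** Otherwise the sets whose complement in K has the property P form a proper filter, which
    clusters at no point of K. *)
Lemma compact_local_ind (T : topologicalType) (K : set T) (P : set T -> Prop) :
  compact K -> P set0 -> (forall A B, A `<=` B -> P B -> P A) ->
  (forall A B, P A -> P B -> P (A `|` B)) ->
  (forall x, K x -> exists2 B, nbhs x B & P B) -> P K.
Proof.
move=> cK P0 Psub PU Ploc; apply: contrapT => nPK.
pose F : set_system T := [set A | P (K `\` A)].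
have FF : ProperFilter F.
  apply: Build_ProperFilter_ex => [A FA|].
    apply: contrapT => /set0P/negP/negPn/eqP A0.
    by apply: nPK; move: FA; rewrite /F /= A0 setD0.
  split; first by rewrite /F /= setDT.
    by move=> A B; rewrite /F /= setDIr; exact: PU.
  by move=> A B AB; apply: Psub; exact: setDS.
have FK : F K by rewrite /F /= setDv.
have [x [Kx xF]] := cK F FF FK.
have [B Bx PB] := Ploc x Kx.
have [|t [nBt Bt]] := xF (~` B) B _ Bx; last exact: nBt.
by rewrite /F /=; apply: Psub PB => t [_ /contrapT].
Qed.

Lemma ultra_compact_cvg (T S : topologicalType) (U : set_system T) (f : T -> S)
    (A : set T) (C : set S) : UltraFilter U -> U A -> compact C ->
  (forall t, A t -> C (f t)) -> exists s : S, f @ U --> s.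
Proof.
move=> UU UA cC fC; have UC : (f @ U) C by exact: (@filterS _ U _ A (f @^-1` C) fC UA).
have [s [_ sU]] := cC (f @ U) _ UC.
exists s => N Ns; have [//|UN] := in_ultra_setVsetC (f @^-1` N) UU.
by have [t []] := sU (~` N) N UN Ns.
Qed.

Section Ascoli.
Context {R : realType} {H F : normedModType R} {Y : set H} {q : smooth_order}.
Hypothesis Yo : open Y.
Implicit Types (A : set (Cp Y F q)) (g : Cp Y F q).

Definition Dn_equicontinuous A := forall m (y : Y) e, in_N q m -> 0 < e ->
  \forall z \near y, forall g, A g -> `|Dn m g z - Dn m g y| <= e.

Lemma near_eval_Dn g m y e : in_N q m -> 0 < e ->
  \forall g' \near g, `|Dn m (g' : Cp Y F q) y - Dn m g y| <= e.
Proof.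
move=> mq e0; have := @continuous_eval_Dn _ _ _ _ _ m y mq g.
move=> /(@cvgrPdist_le _ _ _ (nbhs g))/(_ e e0).
by apply: filterS => g'; rewrite distrC.
Qed.

Lemma closure_Dn A m y g : in_N q m -> closure A g ->
  closure [set Dn m g y | g in A] (Dn m g y).
Proof.
move=> mq Ag N /(@continuous_eval_Dn _ _ _ _ _ m y mq g) Ng.
by have [g' [Ag' Ng']] := Ag _ Ng; exists (Dn m g' y); split=> //; exists g'.
Qed.

Lemma closure_equicontinuous A : Dn_equicontinuous A -> Dn_equicontinuous (closure A).
Proof.
move=> Aeq m y e mq e0; apply: filterS (Aeq m y e mq e0) => z Az g Ag.
apply/ler_addgt0Pr => h h0; have h20 : 0 < h / 2 by rewrite divr_gt0.
have [g' [Ag' [gz gy]]] := Ag _ (filterI (near_eval_Dn g z mq h20) (near_eval_Dn g y mq h20)).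
have -> : Dn m g z - Dn m g y = (Dn m g' z - Dn m g' y) +
   ((Dn m g' y - Dn m g y) - (Dn m g' z - Dn m g z)) by linear_combination R.
apply: le_trans (ler_normD _ _) _; apply: lerD; first exact: Az.
by rewrite [h]splitr; apply: le_trans (ler_normB _ _) _; apply: lerD.
Qed.

(** By the mean value inequality, equicontinuity of the derivatives of order m + 1 makes
    those of order m uniformly differentiable; this survives pointwise limits. *)
Lemma equicontinuous_derivative A m (y : Y) e : Dn_equicontinuous A ->
  in_N q m.+1 -> 0 < e -> \forall z \near y, forall g, A g ->
  `|Dn m g z - Dn m g y - contr (val z - val y) (Dn m.+1 g y)| <=
    e * `|val z - val y|.
Proof.
move=> Aeq mq e0.
have [d d0 dA] := (near_subtypeP _ _).1 (Aeq m.+1 y e mq e0).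
have [r r0 rY] := open_ball_sub Yo y.
apply/near_subtypeP; exists (Num.min d r); first by rewrite lt_min d0.
move=> z; rewrite lt_min => /andP[zd zr] g Ag.
have seg s t : `|val z - val y| < s -> 0 <= t <= 1 ->
    `|val y + t *: (val z - val y) - val y| < s.
  move=> zs t01; apply: segment_ball => //.
  by rewrite subrr normr0 (le_lt_trans _ zs).
apply: (Dn_mean_value Yo (Cp_is g) mq) => [t t01|w t t01 wt].
  by apply: rY; exact: seg.
by apply: dA => //; rewrite wt; exact: seg.
Qed.

(** Along an ultrafilter all derivatives converge pointwise, by precompactness. The limits
    G m are derivatives of each other by the uniform differentiability, so they are the
    jet of a limit function, and equicontinuity makes the convergence uniform on compact
    sets. *)
Lemma Cp_ascoli A :
  (forall m y, in_N q m -> precompact [set Dn m g y | g in A]) ->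
  Dn_equicontinuous A -> precompact A.
Proof.
move=> Apc Aeq; rewrite precompactE compact_ultra => U UU UA.
have Beq := closure_equicontinuous Aeq.
pose G m (y : Y) : Sym m H F :=
  xget 0 [set L : Sym m H F | (fun g : Cp Y F q => Dn m g y) @ U --> L].
have UG m y e : in_N q m -> 0 < e -> \forall g \near U, `|Dn m (g : Cp Y F q) y - G m y| <= e.
  move=> mq e0.
  have : exists L : Sym m H F, (fun g : Cp Y F q => Dn m g y) @ U --> L.
    apply: (@ultra_compact_cvg _ _ U _ (closure A) (closure [set Dn m g y | g in A])) => //.
      by rewrite -precompactE; exact: Apc.
    by move=> g; exact: closure_Dn.
  move=> [L UL]; have : (fun g => Dn m g y) @ U --> G m y.
    exact: (@xgetPex _ 0 [set L : Sym m H F | (fun g : Cp Y F q => Dn m g y) @ U --> L] (ex_intro _ L UL)).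
  move=> /(@cvgrPdist_le _ _ _ U)/(_ e e0).
  by apply: filterS => g; rewrite distrC.
have Geq m (y : Y) e : in_N q m -> 0 < e -> \forall z \near y, `|G m z - G m y| <= e.
  move=> mq e0; apply: filterS (Beq m y e mq e0) => z Bz.
  apply/ler_addgt0Pr => h h0; have h20 : 0 < h / 2 by rewrite divr_gt0.
  have [g [Bg [gz gy]]] := filter_ex (filterI UA (filterI (UG m z _ mq h20) (UG m y _ mq h20))).
  have -> : G m z - G m y = (Dn m g z - Dn m g y) +
     ((Dn m g y - G m y) - (Dn m g z - G m z)) by linear_combination R.
  apply: le_trans (ler_normD _ _) _; apply: lerD; first exact: Bz.
  by rewrite [h]splitr; apply: le_trans (ler_normB _ _) _; apply: lerD.
have Gder m : in_N q m.+1 -> forall y, is_Sym_derivative (G m) y (G m.+1 y).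
  move=> mq y; apply/(is_Sym_derivativeP Yo) => e e0.
  apply: filterS (equicontinuous_derivative y Beq mq e0) => z Bz.
  set t := `|val z - val y|.
  apply/ler_addgt0Pr => h h0.
  have t20 : 0 < 2 + t by rewrite ltr_wpDr// /t.
  pose k := h / (2 + t); have k0 : 0 < k by rewrite divr_gt0.
  have hE : h = k + k + k * t by rewrite /k; field; rewrite gt_eqF.
  have mq' := in_NS mq.
  have [g [Bg [gz [gy g'y]]]] := filter_ex (filterI UA (filterI (UG m z _ mq' k0)
    (filterI (UG m y _ mq' k0) (UG m.+1 y _ mq k0)))).
  have -> : G m z - G m y - contr (val z - val y) (G m.+1 y) =
    (Dn m g z - Dn m g y - contr (val z - val y) (Dn m.+1 g y)) +
    ((Dn m g y - G m y) - (Dn m g z - G m z) +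
     contr (val z - val y) (Dn m.+1 g y - G m.+1 y)).
    by rewrite contrBr; linear_combination R.
  apply: le_trans (ler_normD _ _) _; apply: lerD; first exact: Bz.
  rewrite hE; apply: le_trans (ler_normD _ _) _; apply: lerD.
    by apply: le_trans (ler_normB _ _) _; apply: lerD.
  by apply: le_trans (norm_contr _ _) _; rewrite ler_wpM2r// /t.
have [gq DG] : is_Cp q (fun y => G 0%N y (fun=> 0)) /\
    forall k, in_N q k -> forall y, Dn k (fun y => G 0%N y (fun=> 0)) y = G k y.
  apply: is_Cp_jets => [y|//|k kq y]; first by rewrite Sym_constK.
  by apply/continuous_subtypeP => e e0; exact: Geq.
pose g0 : Cp Y F q := MkCp ((Cp_predP _ _).2 gq).
have Ug : U --> g0.
  apply: cvg_rho => K k e cK kq e0.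
  have e2 : 0 < e / 2 by rewrite divr_gt0.
  suff : \forall g \near U, forall y, K y -> forall j, (j < k.+1)%N ->
      `|Dn j (g : Cp Y F q) y - Dn j g0 y| <= e / 2.
    apply: filterS => g gK; apply: le_lt_trans (_ : e / 2 < e); last by lra.
    apply: rho_le => [|j y jk Ky]; first exact: ltW.
    by rewrite DnB ?(in_N_le kq)//; exact: gK.
  have e6 : 0 < e / 6 by rewrite divr_gt0.
  have := (compact_near_coveringP K).1 cK _ U (fun (g : Cp Y F q) y => forall j, (j < k.+1)%N ->
      `|Dn j g y - Dn j g0 y| <= e / 2) _.
  apply=> y Ky.
  have n1 : \forall z \near y, forall j, (j < k.+1)%N ->
      (forall g, closure A g -> `|Dn j g z - Dn j g y| <= e / 6) /\
      `|G j z - G j y| <= e / 6.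
    apply: (@near_all_lt _ (nbhs y)) => j jk; have jq := in_N_le kq jk.
    by apply: filterS2 (Beq j y _ jq e6) (Geq j y _ jq e6) => z.
  have n2 : \forall g \near U, closure A g /\ forall j, (j < k.+1)%N ->
      `|Dn j (g : Cp Y F q) y - G j y| <= e / 6.
    apply: filterI => //; apply: near_all_lt => j jk.
    by apply: UG => //; exact: (in_N_le kq jk).
  exists ([set z | forall j, (j < k.+1)%N ->
      (forall g, closure A g -> `|Dn j g z - Dn j g y| <= e / 6) /\
      `|G j z - G j y| <= e / 6], [set g | closure A g /\ forall j, (j < k.+1)%N ->
      `|Dn j g y - G j y| <= e / 6]) => //= -[z g] /= [zP [Bg gP]] j jk.
  rewrite DG; last exact: (in_N_le kq jk).
  have [/(_ g Bg) z1 z2] := zP j jk; have z3 := gP j jk.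
  have -> : Dn j g z - G j z = (Dn j g z - Dn j g y) + (Dn j g y - G j y) -
    (G j z - G j y) by linear_combination R.
  have -> : e / 2 = e / 6 + e / 6 + e / 6 by lra.
  apply: le_trans (ler_normB _ _) _; apply: lerD => //.
  by apply: le_trans (ler_normD _ _) _; apply: lerD.
exists g0; split=> //.
have /closure_id -> : closed (closure A) by exact: closed_closure.
move=> N /Ug UN; exact: filter_ex (filterI UA UN).
Qed.

Lemma precompact_Dn A m y : in_N q m -> precompact A ->
  precompact [set Dn m g y | g in A].
Proof.
move=> mq [C AC [cC _]].
have cD : compact [set Dn m g y | g in C].
  apply: continuous_compact => //; apply: continuous_subspaceT.
  exact: continuous_eval_Dn.
exists [set Dn m g y | g in C]; first by move=> _ [g Ag <-]; exists g => //; exact: AC.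
by split=> //; apply: compact_closed => //; exact: norm_hausdorff.
Qed.

(** Otherwise there are z_n tending to y and g_n in A for which the oscillation of D^m g_n
    between z_n and y exceeds e. The points z_n and y form a compact set, the
    corresponding seminorm controls these oscillations, and by compactness of the
    closure they are small for all g at once when n is large. *)
Lemma precompact_equicontinuous A : precompact A -> Dn_equicontinuous A.
Proof.
move=> [C AC [cC _]] m y e mq e0; apply: contrapT => neq.
have zg n : exists zg : Y * Cp Y F q, [/\ `|val zg.1 - val y| < n.+1%:R^-1, A zg.2 &
    e < `|Dn m zg.2 zg.1 - Dn m zg.2 y|].
  apply: contrapT => nzg; apply: neq; apply/near_subtypeP.
  exists n.+1%:R^-1; first by rewrite invr_gt0.
  move=> z zy g Ag; rewrite leNgt; apply/negP => eg.
  by apply: nzg; exists (z, g).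
have [w wP] := choice zg; pose z n := (w n).1.
have zy : z @ \oo --> y.
  move=> N /near_subtypeP[d d0 dN].
  have : \forall n \near \oo, n.+1%:R^-1 < d by exact: near_infty_natSinv_lt (PosNum d0).
  apply: filterS => n nd; apply: dN; have [zn _ _] := wP n.
  exact: lt_trans nd.
have cK := compact_cvg_seq zy.
have e3 : 0 < e / 3 by rewrite divr_gt0.
have : \forall n \near \oo, C `<=` (fun g : Cp Y F q => `|Dn m g (z n) - Dn m g y| <= e).
  apply: (compact_near_coveringP C).1 => // b Cb.
  have [_ /(_ m mq y)] := Cp_is b.
  move=> /continuous_subtypeP/(_ _ e3)/zy nb.
  exists ([set g | rho ([set y] `|` range z) m (g - b : Cp Y F q) < e / 3],
     [set n | `|Dn m b (z n) - Dn m b y| <= e / 3]).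
    by split=> //=; exact: near_rho.
  move=> [g n] /= [gb bn].
  have gbD x : ([set y] `|` range z) x -> `|Dn m g x - Dn m b x| <= e / 3.
    move=> Kx; rewrite -DnB//; apply: le_trans (ltW gb); exact: Dn_le_rho.
  have -> : Dn m g (z n) - Dn m g y = (Dn m g (z n) - Dn m b (z n)) +
    (Dn m b (z n) - Dn m b y) - (Dn m g y - Dn m b y) by linear_combination R.
  have -> : e = e / 3 + e / 3 + e / 3 by lra.
  apply: le_trans (ler_normB _ _) _; apply: lerD => //.
    by apply: le_trans (ler_normD _ _) _; apply: lerD => //; apply: gbD; right; exists n.
  by apply: gbD; left.
move=> /filter_ex[n Cn]; have [_ Aw ew] := wP n.
by have := Cn _ (AC _ Aw); rewrite leNgt ew.
Qed.

End Ascoli.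

(** * Compact operators between normed spaces *)

Section CompactOperators.
Context {R : realType} {V W : normedModType R}.

Lemma precompact_image (T S : topologicalType) (f : T -> S) (A : set T) :
  hausdorff_space S -> continuous f -> precompact A -> precompact (f @` A).
Proof.
move=> hS cf [C AC [cC _]]; exists (f @` C).
  by move=> _ [t At <-]; exists t => //; exact: AC.
have cfC : compact (f @` C).
  by apply: continuous_compact => //; exact: continuous_subspaceT.
by split=> //; exact: compact_closed.
Qed.

Lemma precompact_add (A B : set W) : precompact A -> precompact B ->
  precompact [set a + b | a in A & b in B].
Proof.
move=> [C AC [cC _]] [D BD [cD _]].
have cCD : compact ((fun ab : W * W => ab.1 + ab.2) @` (C `*` D)).
  apply: continuous_compact; last exact: compact_setX.
  by apply: continuous_subspaceT => ab; exact: add_continuous.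
exists ((fun ab : W * W => ab.1 + ab.2) @` (C `*` D)).
  move=> _ [a Aa [b Bb <-]]; exists (a, b) => //; split; [exact: AC|exact: BD].
by split=> //; apply: compact_closed => //; exact: norm_hausdorff.
Qed.

Lemma precompact_sum n (A : 'I_n -> set W) : (forall i, precompact (A i)) ->
  precompact [set w | exists a : 'I_n -> W, (forall i, A i (a i)) /\ w = \sum_i a i].
Proof.
elim: n A => [|n IH] A pA.
  apply: (@precompact_subset _ _ [set 0]).
    by move=> w [a [_ ->]]; rewrite big_ord0.
  rewrite precompact_closed; first exact: compact_set1.
  by apply: compact_closed; [exact: norm_hausdorff|exact: compact_set1].
have := precompact_add (IH (fun i => A (widen_ord (leqnSn n) i)) (fun i => pA _)) (pA ord_max).
apply: precompact_subset => w [a [Aa ->]]; rewrite big_ord_recr /=.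
exists (\sum_(i < n) a (widen_ord (leqnSn n) i)); last by exists (a ord_max).
by exists (fun i => a (widen_ord (leqnSn n) i)).
Qed.

(** Translate and rescale the ball contained in the given open set. *)
Lemma compact_operator_ball (A : V -> W) : compact_operator A ->
  precompact (A @` [set v | `|v| <= 1]).
Proof.
move=> [linA [U [oU [v0 Uv0] pU]]].
have /nbhs_ballP[r /= r0 rU] : nbhs v0 U by exact: open_nbhs_nbhs.
have r20 : 0 < r / 2 by rewrite divr_gt0.
have cf : continuous (fun s : W => (r / 2)^-1 *: (s - A v0)).
  move=> s; apply: (@cvgZl_tmp _ _ _ (nbhs s) _ (r / 2)^-1 (fun s => s - A v0)).
  by apply: (@cvgB _ _ _ (nbhs s)); [exact: cvg_id|exact: cvg_cst].
apply: precompact_subset (precompact_image (@norm_hausdorff _ W) cf pU) => _ [v v1 <-].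
exists (A (r / 2 *: v + v0)).
  exists (r / 2 *: v + v0) => //; apply: rU; rewrite -ball_normE /=.
  rewrite opprD addrCA subrr addr0 normrN normrZ gtr0_norm//.
  by apply: le_lt_trans (_ : r / 2 * 1 < r); [rewrite ler_wpM2l// ltW|lra].
by rewrite linA addrK scalerA mulVf ?scale1r// gt_eqF.
Qed.

Lemma operator_norm_ge (A B : V -> W) v : bounded_linear_operator A ->
  bounded_linear_operator B -> `|v| <= 1 -> `|A v - B v| <= operator_norm (A - B).
Proof.
move=> [_ [M AM]] [_ [N BN]] v1; apply: ub_le_sup; last by exists v.
exists (`|M| + `|N|) => _ [w w1 <-]; rewrite !fctE.
apply: le_trans (ler_normB _ _) _; apply: lerD.
  apply: le_trans (AM w) _; apply: le_trans (_ : `|M| * `|w| <= _).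
    by rewrite ler_wpM2r// ler_norm.
  by rewrite ler_piMr.
apply: le_trans (BN w) _; apply: le_trans (_ : `|N| * `|w| <= _).
  by rewrite ler_wpM2r// ler_norm.
by rewrite ler_piMr.
Qed.

End CompactOperators.

(** * Disjoint functions and sums of C^p functions *)

Section DisjointJets.
Context {R : realType} {G E : normedModType R} {X : set G}.
Hypothesis Xo : open X.

Let disjoint_step (V : normedModType R) k (u : X -> V) (v : X -> Sym k G E) L (x : X) :
  (forall z, u z = 0 \/ v z = 0) -> {for x, continuous u} ->
  is_Sym_derivative v x L -> u x = 0 \/ L = 0.
Proof.
move=> uv cu dv; have [->|ux] := eqVneq (u x) 0; [by left|right].
apply: is_Sym_derivative_unique dv _.
apply: Sym_derivative_near_eq (is_Sym_derivative0 _ x) => //.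
have u0 : 0 < `|u x| / 2 by rewrite divr_gt0// normr_gt0.
have /continuous_subtypeP/(_ _ u0) := cu.
apply: filterS => z uz; have [uz0|->//] := uv z.
move: uz; rewrite uz0 sub0r normrN => uz.
by exfalso; move: u0 uz; lra.
Qed.

(** If u and v are disjoint, u continuous and v differentiable, then u and Dv are disjoint:
    where u is nonzero, v vanishes in a neighbourhood. Applying this to the successive
    derivatives of f, and then to those of g, separates the whole jets. *)
Lemma disjoint_Dn p (f g : X -> E) : is_Cp p f -> is_Cp p g -> disjoint_functions f g ->
  forall j k x, in_N p j -> in_N p k -> Dn j f x = 0 \/ Dn k g x = 0.
Proof.
move=> fp gp fg.
have fg0 j x : in_N p j -> Dn j f x = 0 \/ Dn 0 g x = 0.
  elim: j x => [|j IH] x jp.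
    by have [fx|gx] := fg x; [left|right]; apply: Sym_inj => v /=; rewrite ?fx ?gx.
  have [] : Dn 0 g x = 0 \/ Dn j.+1 f x = 0; [|by right|by left].
  apply: (@disjoint_step _ j (Dn 0 g) (Dn j f)).
  - by move=> z; have [->|->] := IH z (in_NS jp); [right|left].
  - by have [_ cg] := gp; apply: cg; case: (p).
  - exact: is_Cp_derivative fp jp.
move=> j k x jp; elim: k x => [|k IH] x kp; first exact: fg0.
apply: (@disjoint_step _ k (Dn j f) (Dn k g)).
- by move=> z; exact: IH (in_NS kp).
- by have [_ cf] := fp; exact: cf.
- exact: is_Cp_derivative gp kp.
Qed.

Lemma is_Cp_add p (f g : X -> E) : is_Cp p f -> is_Cp p g -> is_Cp p (f + g).
Proof.
move=> /Cp_predP fp /Cp_predP gp; apply/Cp_predP.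
have [_ lin] := @Cp_submod R G E X p.
by have := lin 1 _ _ fp gp; rewrite scale1r.
Qed.

Lemma is_Cp_sum p n (f : 'I_n -> X -> E) : (forall i, is_Cp p (f i)) ->
  is_Cp p (fun x => \sum_i f i x) /\
  forall k x, in_N p k -> Dn k (fun x => \sum_i f i x) x = \sum_i Dn k (f i) x.
Proof.
elim: n f => [|n IH] f fp.
  have -> : (fun x => \sum_(i < 0) f i x) = 0 :> (X -> E).
    by apply/funext => x; rewrite big_ord0.
  split=> [|k x kp]; last by rewrite Dn_cst0 big_ord0.
  by apply/Cp_predP; have [] := @Cp_submod R G E X p.
have -> : (fun x => \sum_(i < n.+1) f i x) =
   (fun x => \sum_(i < n) f (widen_ord (leqnSn n) i) x) + f ord_max.
  by apply/funext => x; rewrite fctE big_ord_recr.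
have [sp DS] := IH (fun i => f (widen_ord (leqnSn n) i)) (fun i => fp _).
split; first exact: is_Cp_add.
move=> k x kp; rewrite big_ord_recr /= -DS//.
set S := fun x => _; have := Dn_lin 1 sp (fp ord_max) kp.
by rewrite !scale1r => ->.
Qed.

End DisjointJets.

(** * Representable operators are compact and separating *)

Section Sufficiency.
Context {R : realType} {G H E F : normedModType R} {X : set G} {Y : set H}
  {p q : smooth_order}.
Hypotheses (Xo : open X) (Yo : open Y).

(** The ball {rho K l < 1}, with K the closure of the points x_i, has jets of norm at most 1 at
    all x_i; hence its image has derivatives in a finite sum of precompact sets, and the
    norm continuity of y |-> D_y^m Phi_k(y, .) gives equicontinuity. *)
Lemma representable_compact (T : Cp X E p -> Y -> F) : representable q T ->
  exists T' : Cp X E p -> Cp Y F q,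
    [/\ forall f, (T' f : Y -> F) = T f, compact_operator T' & separating T'].
Proof.
move=> [l [Phi [I [x_ [Y_ [lp pcx [[covY _ _] clo] TE adm]]]]]].
have Yi (y : Y) : exists i, Y_ i y.
  have : cover [set: I] Y_ y by rewrite covY.
  by move=> [i _ iy]; exists i.
have admk (k : 'I_l.+1) : admissible q (Phi k) by apply: adm; rewrite -ltnS.
have jl (k : 'I_l.+1) : in_N p k by apply: in_N_le lp _; rewrite -ltnS.
have bPhi (k : 'I_l.+1) y : bounded_linear_operator (Phi k y) by have [] := admk k.
have qPhi (k : 'I_l.+1) S : is_Cp q (fun y => Phi k y S) by have [] := admk k.
pose S_ i (f : Cp X E p) := fun y => \sum_(k < l.+1) Phi k y (Dn k f (x_ i)).
have S_q i f : is_Cp q (S_ i f).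
  by have [] := is_Cp_sum (fun k : 'I_l.+1 => qPhi k (Dn k f (x_ i))).
have DS i f m y : in_N q m ->
    Dn m (S_ i f) y = \sum_(k < l.+1) DPhi m (Phi k) y (Dn k f (x_ i)).
  move=> mq.
  by have [_ ->] := is_Cp_sum (fun k : 'I_l.+1 => qPhi k (Dn k f (x_ i))).
have nearYi i (y : Y) : Y_ i y -> \forall z \near y, Y_ i z.
  by move=> iy; apply: open_nbhs_nbhs; split=> //; have [] := clo i.
have near_TS i f (y : Y) : Y_ i y -> \forall z \near y, T f z = S_ i f z.
  by move=> iy; apply: filterS (nearYi i y iy) => z; exact: TE.
have Tq f : is_Cp q (T f).
  apply: is_Cp_near => // y; have [i iy] := Yi y.
  by exists (S_ i f) => //; exact: near_TS.
have DT i f m y : Y_ i y -> in_N q m ->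
    Dn m (T f) y = \sum_(k < l.+1) DPhi m (Phi k) y (Dn k f (x_ i)).
  by move=> iy mq; rewrite (Dn_near Yo m (near_TS i f y iy)) DS.
pose T' f : Cp Y F q := MkCp ((Cp_predP _ _).2 (Tq f)).
have linT' : linear T'.
  move=> a f g; apply: val_inj; apply/funext => y /=; have [i iy] := Yi y.
  rewrite !fctE (TE _ _ _ iy) (TE f _ _ iy) (TE g _ _ iy) scaler_sumr -big_split /=.
  apply: eq_bigr => k _; rewrite DnP//.
  by have [-> _] := bPhi k y.
exists T'; split=> //; last first.
  move=> f g fg y; have [i iy] := Yi y; rewrite /= (TE f _ _ iy) (TE g _ _ iy).
  have dis (j k : 'I_l.+1) : Dn j f (x_ i) = 0 \/ Dn k g (x_ i) = 0.
    exact: (disjoint_Dn Xo (Cp_is f) (Cp_is g) fg).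
  have Phi0 (k : 'I_l.+1) : Phi k y 0 = 0.
    have [lin _] := bPhi k y; have := lin (-1) 0 0.
    by rewrite scaler0 add0r scaleN1r addNr.
  have [f0|/existsNP[j /eqP fj]] := pselect (forall j : 'I_l.+1, Dn j f (x_ i) = 0).
    by left; rewrite big1// => k _; rewrite f0.
  right; rewrite big1// => k _; have [/eqP|->//] := dis j k.
  by rewrite (negbTE fj).
split=> //.
pose K := closure (range x_).
have cK : compact K by rewrite -precompactE.
pose U := [set f : Cp X E p | rho K l (f - 0 : Cp X E p) < 1].
have r0 : rho K l (0 : Cp X E p) <= 0.
  by apply: (@rho_le _ _ _ _ _ 0 K l 0) => // j x _ _; rewrite Dn0 normr0.
have U1 f i (k : 'I_l.+1) : U f -> `|Dn k f (x_ i)| <= 1.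
  rewrite /U /= subr0 => /ltW; apply: le_trans.
  apply: Dn_le_rho => //; first by rewrite -ltnS.
  by apply: subset_closure; exists i.
exists U; split.
- by apply: open_subbase; exists 0, K, l, 1.
- exists 0; have -> : U 0 = (rho K l (0 - 0 : Cp X E p) < 1) by [].
  by rewrite subrr; exact: le_lt_trans r0 _.
apply: Cp_ascoli => // [m y mq|m y e mq e0].
  have [i iy] := Yi y.
  have pc (k : 'I_l.+1) : precompact (DPhi m (Phi k) y @` [set S | `|S| <= 1]).
    by apply: compact_operator_ball; have [_ _ + _] := admk k; exact.
  apply: precompact_subset (precompact_sum pc) => _ [_ [f Uf <-] <-].
  exists (fun k : 'I_l.+1 => DPhi m (Phi k) y (Dn k f (x_ i))); split.
    by move=> k; exists (Dn k f (x_ i)) => //; exact: U1.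
  exact: DT.
have [i iy] := Yi y; have e1 : 0 < e / l.+1%:R by rewrite divr_gt0.
have near_k (k : 'I_l.+1) : \forall z \near y,
    operator_norm (DPhi m (Phi k) z - DPhi m (Phi k) y) <= e / l.+1%:R.
  have [_ _ _ /(_ m mq)[_ /(_ y)]] := admk k.
  move=> /(@cvgrPdist_le _ _ _ (nbhs y))/(_ _ e1); apply: filterS => z.
  by rewrite sub0r normrN; apply: le_trans; exact: ler_norm.
have near_all : \forall z \near y, forall k, (k < l.+1)%N ->
    operator_norm (DPhi m (Phi k) z - DPhi m (Phi k) y) <= e / l.+1%:R.
  by apply: (@near_all_lt _ (nbhs y)) => k kl; exact: (near_k (Ordinal kl)).
apply: filterS2 near_all (nearYi i y iy) => z zk iz _ [f Uf <-] /=.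
rewrite (DT i f m z)// (DT i f m y)// -sumrB.
apply: le_trans (ler_norm_sum _ _ _) _.
apply: le_trans (_ : \sum_(k < l.+1) (e / l.+1%:R) <= _).
  apply: ler_sum => k _; apply: le_trans (zk k _) => //.
  have [_ _ _ /(_ m mq)[bl _]] := admk k.
  by apply: operator_norm_ge => //; exact: U1.
by rewrite sumr_const card_ord -[leLHS]mulr_natr divfK// pnatr_eq0.
Qed.

End Sufficiency.

(** * Estimates for a compact operator *)

Section CompactEstimates.
Context {R : realType} {G H E F : normedModType R} {X : set G} {Y : set H}
  {p q : smooth_order}.
Hypotheses (Xo : open X) (Yo : open Y).
Implicit Types (f : Cp X E p).

(** By homogeneity, an estimate on the rho-ball of radius e extends to all f. *)
Lemma homogeneous_bound (N : Cp X E p -> R) K l e M : compact K -> in_N p l ->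
  0 < e -> 0 <= M -> (forall a f, N (a *: f) = `|a| * N f) ->
  (forall f, rho K l f < e -> N f <= M) ->
  forall f, N f <= M / e * rho K l f.
Proof.
move=> cK lp e0 M0 Nhom NM f; apply/ler_addgt0Pr => d d0.
pose s := rho K l f + d / (M / e + 1).
have Me0 : 0 <= M / e by rewrite divr_ge0// ltW.
have Me1 : 0 < M / e + 1 by rewrite ltr_wpDl.
have r0 : 0 <= rho K l f by exact: rho_ge0.
have rs : rho K l f < s by rewrite ltrDl divr_gt0.
have s0 : 0 < s by exact: le_lt_trans rs.
have es0 : 0 < e / s by rewrite divr_gt0.
have : N ((e / s) *: f) <= M.
  apply: NM; apply: le_lt_trans (rhoZ _ _ cK lp) _.
  by rewrite gtr0_norm// mulrAC ltr_pdivrMr// ltr_pM2l.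
rewrite Nhom gtr0_norm// mulrC -ler_pdivlMr// => /le_trans; apply.
rewrite invf_div mulrA mulrAC /s mulrDr lerD2l mulrCA.
by rewrite ler_piMr ?(ltW d0)// ler_pdivrMr// mul1r lerDl.
Qed.

(** The open set of the definition contains a ball f0 + {rho K l < e}; as f0 also belongs to
    it, the estimates for its image pass to the ball centred at 0 by subtracting T f0. *)
Lemma compact_operator_estimates (T : Cp X E p -> Cp Y F q) : compact_operator T ->
  exists K l, [/\ compact K, in_N p l,
    forall m (y : Y), in_N q m -> exists2 C, 0 <= C &
      forall f, `|Dn m (T f) y| <= C * rho K l f,
    forall m (y : Y) e, in_N q m -> 0 < e -> \forall z \near y,
      forall f, `|Dn m (T f) z - Dn m (T f) y| <= e * rho K l f
    & exists2 e, 0 < e & forall m (y : Y), in_N q m ->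
      precompact [set Dn m (T f) y | f in [set f : Cp X E p | rho K l f < e]]].
Proof.
move=> [linT [U [oU [f0 Uf0] pU]]].
have TB f g : T (f - g) = T f - T g.
  have -> : f - g = (-1) *: g + f by linear_combination R.
  by rewrite linT; linear_combination R.
have T0 : T 0 = 0 by rewrite -(subrr 0) TB subrr.
have TZ a f : T (a *: f) = a *: T f by rewrite -[a *: f]addr0 linT T0 addr0.
have [K [l [e [cK lp e0 KU]]]] := open_rho oU Uf0.
pose V := [set f : Cp X E p | rho K l f < e].
have VU f : V f -> U (f + f0) by move=> Vf; apply: KU; rewrite addrK.
have Tf0 f : T f = T (f + f0) - T f0 by rewrite -TB addrK.
have pV m (y : Y) : in_N q m -> precompact [set Dn m (T f) y | f in V].
  move=> mq; have cs : continuous (fun s : Sym m H F => s - Dn m (T f0) y).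
    by move=> s; apply: (@cvgB _ _ _ (nbhs s)); [exact: cvg_id|exact: cvg_cst].
  have pUm := precompact_Dn y mq pU.
  apply: precompact_subset (precompact_image (@norm_hausdorff _ _) cs pUm).
  move=> _ [f Vf <-]; exists (Dn m (T (f + f0)) y).
    by exists (T (f + f0)) => //; exists (f + f0) => //; exact: VU.
  by rewrite [in RHS]Tf0 DnB.
exists K, l; split => //; last by exists e.
- move=> m y mq; have [C VC [/compact_bounded[M [_ CM]] _]] := pV m y mq.
  have M0 : 0 <= Num.max 0 (M + 1) by rewrite le_max lexx.
  exists (Num.max 0 (M + 1) / e); first by rewrite divr_ge0// ltW.
  apply: (@homogeneous_bound (fun f => `|Dn m (T f) y|)) => // [a f|f Vf].
    by rewrite TZ DnZ// normrZ.
  apply: (CM (Num.max 0 (M + 1))); last by apply: VC; exists f.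
  by rewrite lt_max ltrDl ltr01 orbT.
- move=> m y d mq d0.
  have de : 0 < d * e / 2 by rewrite divr_gt0// mulr_gt0.
  have := precompact_equicontinuous pU y mq de; apply: filterS => z Uz.
  have -> : d = d * e / e by rewrite mulfK// gt_eqF.
  apply: (@homogeneous_bound (fun f => `|Dn m (T f) z - Dn m (T f) y|)) => //.
  + by rewrite mulr_ge0// ltW.
  + by move=> a f; rewrite TZ !DnZ// -scalerBr normrZ.
  + move=> f Vf; rewrite Tf0 !DnB//.
    have -> : Dn m (T (f + f0)) z - Dn m (T f0) z -
        (Dn m (T (f + f0)) y - Dn m (T f0) y) =
      (Dn m (T (f + f0)) z - Dn m (T (f + f0)) y) -
        (Dn m (T f0) z - Dn m (T f0) y) by linear_combination R.
    rewrite [d * e]splitr; apply: le_trans (ler_normB _ _) _; apply: lerD.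
      by apply: Uz; exists (f + f0) => //; exact: VU.
    by apply: Uz; exists f0.
Qed.

End CompactEstimates.

(** * Bumps of variable radius *)

Section Cutoff.
Context {R : realType} {G E : normedModType R} {X : set G} {p : smooth_order}.
Hypotheses (Xo : open X) (bump : has_bump G p).

(** Dilate the given bump: D^k is multiplied by la^k, with a constant M that does not depend
    on the centre nor on la. *)
Lemma cutoff_exists l : in_N p l -> exists2 M, 0 <= M &
  forall (x : X) la, 0 < la -> exists phi : X -> R^o, [/\ is_Cp p phi,
    forall z, `|val z - val x| <= la^-1 / 2 -> phi z = 1,
    forall z, la^-1 <= `|val z - val x| -> phi z = 0
  & forall k z, (k <= l)%N -> `|Dn k phi z| <= M * la ^+ k].
Proof.
move=> lp; have [phi [phi1 phi0 phiM]] := bump.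
have [M M0 HM] : exists2 M, 0 <= M & forall k z, (k <= l)%N -> `|Dn k phi z| <= M.
  elim: l lp => [|l IH] lp.
    have [M HM] := phiM 0%N lp; exists `|M| => // k z; rewrite leqn0 => /eqP ->.
    exact: le_trans (HM z) (ler_norm _).
  have [M M0 HM] := IH (in_NS lp); have [N HN] := phiM _ lp.
  exists (Num.max M N); first by rewrite le_max M0.
  move=> k z; rewrite leq_eqVlt => /predU1P[->|]; rewrite le_max; first by rewrite HN orbT.
  by rewrite ltnS => kl; rewrite HM.
exists M => // x la la0.
have [pp Dp] := is_Cp_dilate Xo la (val x) (Cp_is phi).
exists (fun z : X => phi (whole_pt (la *: (val z - val x)))); split => //.
- move=> z zx; apply: phi1; rewrite /= normrZ gtr0_norm//.
  by rewrite -ler_pdivlMl.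
- move=> z zx; apply: phi0; rewrite /= normrZ gtr0_norm//.
  by rewrite -ler_pdivrMl// mulr1.
- move=> k z kl; rewrite Dp ?(in_N_le lp)// normrZ normrX gtr0_norm// mulrC.
  by rewrite ler_wpM2r ?exprn_ge0 ?(ltW la0)// HM.
Qed.

Definition cut (phi : X -> R^o) (pp : is_Cp p phi) (f : Cp X E p) : Cp X E p :=
  MkCp ((Cp_predP _ _).2 (is_Cp_scale Xo pp (Cp_is f)).1).

(** The hypotheses on phi and on f scale in the same way, so that Leibniz' formula yields a
    bound of the same form for the product; outside of the ball of radius 1 / la the
    product vanishes with its derivatives. *)
Lemma rho_cut K l M a la (x : X) (phi : X -> R^o) (pp : is_Cp p phi) (f : Cp X E p) :
  in_N p l -> 0 <= M -> 0 <= a -> 1 <= la ->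
  (forall z, la^-1 <= `|val z - val x| -> phi z = 0) ->
  (forall k z, (k <= l)%N -> `|Dn k phi z| <= M * la ^+ k) ->
  (forall k (z : X), (k <= l)%N -> `|val z - val x| <= la^-1 ->
     `|Dn k f z| <= a * la ^+ k) ->
  rho K l (cut pp f) <= 2 ^+ l * (M * a) * la ^+ l.
Proof.
move=> lp M0 a0 la1 phi0 phiM fa.
have la0 : 0 <= la by exact: le_trans la1.
apply: rho_le => [|j z jl _]; first by rewrite !mulr_ge0 ?exprn_ge0.
have [zx|zx] := leP `|val z - val x| la^-1.
  have [_ ->] := is_Cp_scale Xo pp (Cp_is f); last exact: in_N_le lp jl.
  apply: le_trans (norm_leib (al := M) (be := a) (la := la) _ _ _ _ _) _ => //.
  - by move=> i ij; apply: phiM; exact: leq_trans jl.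
  - by move=> i ij; apply: fa => //; exact: leq_trans jl.
  rewrite ler_pM ?mulr_ge0 ?exprn_ge0//; last exact: ler_weXn2l.
  by rewrite ler_wpM2r ?mulr_ge0// ler_weXn2l// ler1n.
rewrite (_ : Dn j _ z = 0) ?normr0 ?mulr_ge0 ?exprn_ge0//.
rewrite (Dn_near Xo j (g := 0)) ?Dn_cst0//.
have d0 : 0 < `|val z - val x| - la^-1 by rewrite subr_gt0.
apply: filterS (near_val_lt z d0) => w wz; rewrite /= phi0 ?scale0r//.
have := ler_distD (val w) (val z) (val x).
rewrite (distrC (val z) (val w)) => h; lra.
Qed.

End Cutoff.

(** * Compact separating operators are representable *)

Section Necessity.
Context {R : realType} {G H E F : normedModType R} {X : set G} {Y : set H}
  {p q : smooth_order}.
Hypotheses (Xo : open X) (Yo : open Y) (bump : has_bump G p).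
Variable T : Cp X E p -> Cp Y F q.
Hypotheses (linT : linear T) (sepT : separating T) (ntT : nowhere_trivial T).
Variables (K : set X) (l : nat).
Hypotheses (cK : compact K) (lp : in_N p l).
Hypothesis boundT : forall m (y : Y), in_N q m -> exists2 C, 0 <= C &
  forall f, `|Dn m (T f) y| <= C * rho K l f.
Hypothesis equiT : forall m (y : Y) e, in_N q m -> 0 < e -> \forall z \near y,
  forall f, `|Dn m (T f) z - Dn m (T f) y| <= e * rho K l f.
Implicit Types (f : Cp X E p) (x : X) (y : Y).

Let TB f g : T (f - g) = T f - T g.
Proof.
have -> : f - g = (-1) *: g + f by linear_combination R.
by rewrite linT; linear_combination R.
Qed.

Let T0 : T 0 = 0. Proof. by rewrite -(subrr 0) TB subrr. Qed.

Let TD f g : T (f + g) = T f + T g.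
Proof. by rewrite -[f]scale1r linT !scale1r. Qed.

Let TBy f g y : T (f - g) y = T f y - T g y. Proof. by rewrite TB. Qed.

Let q0 : in_N q 0. Proof. by case: q. Qed.

Let norm_Ty f y : `|T f y| = `|Dn 0 (T f) y|.
Proof. by rewrite /= norm_Sym_const. Qed.

(** For T separating, this characterizes the value at y of the support map of T. *)
Definition support_point y x :=
  forall f, (\forall z \near x, f z = 0) -> T f y = 0.

(** If no point of K is a support point, P holds locally: near x there is f0 vanishing on a
    ball B with T f0 (y) <> 0, so T kills at y every function carried by B, and f can be
    replaced by its product with 1 minus a bump. By compactness P holds for K,
    and then Tf(y) = 0 for all f because rho K l kills functions vanishing near K. *)
Lemma support_point_exists y : exists2 x, K x & support_point y x.
Proof.
apply: contrapT => nosupp.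
pose P (S : set X) := forall f, exists f' : Cp X E p, [/\ T f' y = T f y,
  forall z, f z = 0 -> f' z = 0 & forall z, S z -> \forall w \near z, f' w = 0].
suff PK : P K.
  have [f Tf] := ntT y; have [f' [Tf' _ f'K]] := PK f.
  move/eqP: Tf; apply; rewrite -Tf'; apply/eqP; rewrite -normr_le0 norm_Ty.
  have [C C0 CT] := boundT y q0; apply: le_trans (CT f') _.
  rewrite -(mulr0 C) ler_wpM2l//; apply: rho_le => // j x _ Kx.
  by rewrite (Dn_near Xo j (g := 0)) ?Dn_cst0 ?normr0//; exact: f'K.
apply: compact_local_ind => //.
- by move=> f; exists f.
- move=> A B AB PB f; have [f' [Tf' f0 f'B]] := PB f; exists f'; split=> // z Az.
  by apply: f'B; exact: AB.
- move=> A B PA PB f; have [f' [Tf' f0 f'A]] := PA f.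
  have [f'' [Tf'' f'0 f''B]] := PB f'; exists f''; split; first by rewrite Tf''.
    by move=> z /f0 /f'0.
  by move=> z [/f'A|/f''B//]; apply: filterS => w /f'0.
- move=> x Kx; have [f0 f0x Tf0] : exists2 f0 : Cp X E p,
      (\forall z \near x, f0 z = 0) & T f0 y <> 0.
    apply: contrapT => nf; apply: nosupp; exists x => // f0 f0x.
    by apply: contrapT => Tf0; apply: nf; exists f0.
  have [d d0 df0] := (near_subtypeP _ _).1 f0x.
  have [M M0 cutM] := cutoff_exists Xo bump lp.
  have di : 0 < d^-1 by rewrite invr_gt0.
  have [phi [pp phi1 phi0 _]] := cutM x _ di.
  rewrite invrK in phi1 phi0.
  have d20 : 0 < d / 2 by rewrite divr_gt0.
  exists [set z : X | `|val z - val x| < d / 2]; first exact: near_val_lt.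
  move=> f; exists (f - cut Xo pp f : Cp X E p).
  have dis : disjoint_functions (cut Xo pp f : X -> E) (f0 : X -> E).
    move=> z; have [zd|zd] := ltP `|val z - val x| d; first by right; exact: df0.
    by left; rewrite /= phi0// scale0r.
  have Tcut : T (cut Xo pp f) y = 0 by have [|/Tf0] := sepT dis y.
  split; first by rewrite TBy Tcut subr0.
    by move=> z fz; rewrite -[LHS]/(f z - _ *: f z) fz scaler0 subr0.
  move=> z zd; have e0 : 0 < d / 2 - `|val z - val x| by rewrite subr_gt0.
  apply: filterS (near_val_lt z e0) => w wz.
  rewrite -[LHS]/(f w - phi w *: f w) phi1 ?scale1r ?subrr//.
  have := ler_distD (val z) (val w) (val x) => h; lra.
Qed.

Lemma support_point_cut y x (phi : X -> R^o) (pp : is_Cp p phi) f :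
  support_point y x -> (\forall z \near x, phi z = 1) -> T (cut Xo pp f) y = T f y.
Proof.
move=> sx phi1; apply/eqP; rewrite eq_sym -subr_eq0 -TBy; apply/eqP; apply: sx.
apply: filterS phi1 => z phiz.
by rewrite -[LHS]/(f z - phi z *: f z) phiz scale1r subrr.
Qed.

Let bump_at x r : 0 < r -> exists phi : X -> R^o, [/\ is_Cp p phi,
  \forall z \near x, phi z = 1 & forall z, r <= `|val z - val x| -> phi z = 0].
Proof.
move=> r0; have [M M0 cutM] := cutoff_exists Xo bump lp.
have ri : 0 < r^-1 by rewrite invr_gt0.
have [phi [pp phi1 phi0 _]] := cutM x _ ri; rewrite invrK in phi1 phi0.
exists phi; split=> //; apply: filterS (near_val_lt x (divr_gt0 r0 (ltr0n _ 2))) => z zx.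
by apply: phi1; exact: ltW.
Qed.

Lemma cut_far (phi : X -> R^o) (pp : is_Cp p phi) f x x' r :
  (forall z, r <= `|val z - val x| -> phi z = 0) -> r < `|val x' - val x| ->
  \forall z \near x', cut Xo pp f z = 0.
Proof.
move=> phi0 xx'; have d0 : 0 < `|val x' - val x| - r by rewrite subr_gt0.
apply: filterS (near_val_lt x' d0) => z zx'; rewrite /= phi0 ?scale0r//.
have := ler_distD (val z) (val x') (val x).
rewrite (distrC (val x') (val z)) => h; lra.
Qed.

(** Choose Tf(y) <> 0 with f carried by a ball around x; then Tf(z) <> 0 for z near y, so
    that no support point of z lies outside of this ball. *)
Lemma support_point_continuous y x r : support_point y x -> 0 < r ->
  \forall z \near y, forall x', support_point z x' -> `|val x' - val x| <= r.
Proof.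
move=> sx r0; have [phi [pp phi1 phi0]] := bump_at x r0.
have [f] := ntT y; rewrite -(support_point_cut pp f sx phi1) => Tf.
have [_ /(_ 0%N q0 y)] := Cp_is (T (cut Xo pp f)).
have T20 : 0 < `|T (cut Xo pp f) y| / 2 by rewrite divr_gt0// normr_gt0.
move=> /continuous_subtypeP/(_ _ T20); apply: filterS => z Tz x' sx'.
rewrite leNgt; apply/negP => rx'; have := sx' _ (cut_far pp f phi0 rx') => Tz0.
move: Tz; rewrite -[Dn 0 _ z]/(Sym_const _) Tz0 -[Dn 0 _ y]/(Sym_const _).
rewrite -Sym_constB norm_Sym_const sub0r normrN => h; move: T20 h; lra.
Qed.

(** Multiplying f by a bump of small radius 1 / la around the support point does not
    change Tf(y); if the l-jet of f vanishes there, the seminorm rho of the product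
    tends to 0 with 1 / la. *)
Lemma flat_support_point y x f : support_point y x ->
  (forall j, (j <= l)%N -> Dn j f x = 0) -> T f y = 0.
Proof.
move=> sx f0; have [C C0 CT] := boundT y q0.
have [M M0 cutM] := cutoff_exists Xo bump lp.
apply/eqP; rewrite -normr_le0; apply/ler_addgt0Pr => e e0; rewrite add0r.
pose B := C * (2 ^+ l * M); have B0 : 0 <= B by rewrite !mulr_ge0 ?exprn_ge0.
have B1 : 0 < B + 1 by rewrite ltr_wpDl.
pose d := e / (B + 1); have d0 : 0 < d by rewrite divr_gt0.
have [r0 r00 r0X] := open_ball_sub Xo x.
have [_ /(_ l lp x)] := Cp_is f.
move=> /continuous_subtypeP/(_ _ d0)/near_subtypeP[r1 r10 r1f].
pose r := Num.min r0 r1; have rr : 0 < r by rewrite lt_min r00.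
pose la := Num.max 1 (2 / r).
have la1 : 1 <= la by rewrite le_max lexx.
have la0 : 0 < la by exact: lt_le_trans la1.
have lar : la^-1 < r.
  rewrite invf_plt ?posrE//; apply: lt_le_trans (_ : 2 / r <= _).
    by rewrite -[X in X < _]mul1r ltr_pM2r ?invr_gt0// ltr1n.
  by rewrite le_max lexx orbT.
have [phi [pp phi1 phi0 phiM]] := cutM x _ la0.
have phi1' : \forall z \near x, phi z = 1.
  have la20 : 0 < la^-1 / 2 by rewrite divr_gt0// invr_gt0.
  by apply: filterS (near_val_lt x la20) => z zx; apply: phi1; exact: ltW.
have flat := @Dn_flat_bound _ _ _ _ Xo p f l d (val x) r x (Cp_is f) lp.
have fbound k z : (k <= l)%N -> `|val z - val x| <= la^-1 ->
    `|Dn k f z| <= d * la^-1 ^+ l * la ^+ k.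
  move=> kl zx; have zr : `|val z - val x| < r by exact: le_lt_trans lar.
  have := flat _ _ _ _ (l - k)%N k z; rewrite subnK// => /(_ _ _ _ _ erefl zr) H1.
  apply: le_trans (H1 _ _ _ _) _.
  - by move=> w wr; apply: r0X; apply: lt_le_trans wr _; rewrite ge_min lexx.
  - by rewrite subrr normr0.
  - by move=> j jl; apply: f0; exact: ltnW.
  - move=> w wr; have := r1f w; rewrite f0// subr0; apply.
    by apply: lt_le_trans wr _; rewrite ge_min lexx orbT.
  rewrite -mulrA ler_wpM2l ?(ltW d0)//.
  have -> : la^-1 ^+ l * la ^+ k = la^-1 ^+ (l - k).
    rewrite -[in LHS](subnK kl) exprD -mulrA -exprMn mulVf ?gt_eqF//.
    by rewrite expr1n mulr1.
  by rewrite lerXn2r// nnegrE// invr_ge0 ltW.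
have a0 : 0 <= d * la^-1 ^+ l by rewrite mulr_ge0 ?exprn_ge0 ?invr_ge0 ?ltW.
rewrite -(support_point_cut pp f sx phi1') norm_Ty; apply: le_trans (CT _) _.
have := @rho_cut _ _ _ X p Xo K l M _ la x phi pp f lp M0 a0 la1 phi0 phiM fbound.
have -> : 2 ^+ l * (M * (d * la^-1 ^+ l)) * la ^+ l = 2 ^+ l * M * d.
  by rewrite exprVn; field; rewrite expf_neq0// gt_eqF.
move=> /(ler_wpM2l C0)/le_trans; apply.
rewrite mulrA -/B /d mulrCA ler_piMr ?(ltW e0)// ler_pdivrMr// mul1r lerDl.
exact: ler01.
Qed.


Let h y : X := projT1 (cid2 (support_point_exists y)).
Let hK y : K (h y). Proof. by rewrite /h; case: cid2. Qed.
Let hs y : support_point y (h y). Proof. by rewrite /h; case: cid2. Qed.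

Definition Cp_monomial k (x : X) (S : Sym k G E) : Cp X E p :=
  MkCp ((Cp_predP _ _).2 (is_Cp_monomial p (val x) S Xo).1).

Lemma Dn_Cp_monomial k x (S : Sym k G E) j z : in_N p j ->
  Dn j (Cp_monomial x S) z = monomial_jet j S (val z - val x).
Proof. by move=> jp; exact: ((is_Cp_monomial p (val x) S Xo).2 j jp z). Qed.

Lemma Cp_monomial_lin k x a (S S' : Sym k G E) :
  Cp_monomial x (a *: S + S') = a *: Cp_monomial x S + Cp_monomial x S'.
Proof.
apply: val_inj; apply/funext => z.
rewrite -[LHS]/(k`!%:R^-1 *: (a *: diag S (val z - val x) + diag S' (val z - val x))).
rewrite -[RHS]/(a *: (k`!%:R^-1 *: diag S (val z - val x)) +
  k`!%:R^-1 *: diag S' (val z - val x)).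
by linear_combination R.
Qed.

Lemma rho_Cp_monomial x : exists2 D, 0 <= D & forall k (S : Sym k G E), (k <= l)%N ->
  rho K l (Cp_monomial x S) <= D * `|S|.
Proof.
have [N HN] : exists N, forall z, K z -> `|val z - val x| <= N.
  have : compact ((fun z : X => val z - val x) @` K).
    apply: continuous_compact => //; apply: continuous_subspaceT => z.
    apply: (@cvgB _ _ _ (nbhs z)); last exact: cvg_cst.
    exact: (@initial_continuous X G set_val z).
  move=> /compact_bounded[N [_ NK]]; exists (N + 1) => z Kz.
  by apply: (NK (N + 1)); [rewrite ltrDl | exists z].
pose D := Num.max 1 N; have D1 : 1 <= D by rewrite le_max lexx.
have D0 : 0 <= D by exact: le_trans D1.
exists (D ^+ l); first exact: exprn_ge0.
move=> k S kl; apply: rho_le => [|j z jl Kz]; first by rewrite mulr_ge0 ?exprn_ge0.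
rewrite Dn_Cp_monomial ?(in_N_le lp)//.
have [jk|kj] := leqP j k; last first.
  by rewrite monomial_jet_gt// normr0 mulr_ge0 ?exprn_ge0.
apply: le_trans (norm_monomial_jet _ _ jk) _; rewrite mulrC ler_wpM2r//.
apply: le_trans (_ : D ^+ (k - j) <= _).
  by rewrite lerXn2r ?nnegrE// le_max HN ?orbT.
by apply: ler_weXn2l => //; apply: leq_trans (leq_subr _ _) kl.
Qed.

Let Phi k y (S : Sym k G E) : F := T (Cp_monomial (h y) S) y.

Let Phi_linear k y : linear (@Phi k y).
Proof. by move=> a S S'; rewrite /Phi Cp_monomial_lin linT. Qed.

(** Subtracting the Taylor polynomial of f at the support point leaves a function
    with zero jet. *)
Lemma representation y f : T f y = \sum_(k < l.+1) Phi y (Dn k f (h y)).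
Proof.
pose P n := \sum_(k < n) Cp_monomial (h y) (Dn k f (h y)).
have TP n : T (P n) y = \sum_(k < n) Phi y (Dn k f (h y)).
  elim: n => [|n IH]; first by rewrite /P !big_ord0 T0.
  by rewrite /P !big_ord_recr /= TD -IH.
have DP n j : in_N p j -> Dn j (P n) (h y) = if (j < n)%N then Dn j f (h y) else 0.
  move=> jp; elim: n => [|n IH]; first by rewrite /P big_ord0 Dn0.
  have -> : P n.+1 = P n + Cp_monomial (h y) (Dn n f (h y)) by rewrite /P big_ord_recr.
  rewrite DnD// IH Dn_Cp_monomial// subrr ltnS.
  case: (ltngtP j n) => /= jn.
  - by rewrite monomial_jet_lt// addr0.
  - by rewrite monomial_jet_gt// addr0.
  - by rewrite -jn monomial_jet_diag add0r.
rewrite -TP; apply/eqP; rewrite -subr_eq0 -TBy; apply/eqP.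
apply: (flat_support_point (x := h y)) => [|j jl].
  exact: hs.
by rewrite DnB ?(in_N_le lp)// DP ?(in_N_le lp)// ltnS jl subrr.
Qed.

Hypothesis pq : le_order p q.

Let q_of_p m : in_N p m -> in_N q m.
Proof. by case: p pq => [p'|]; case: q => [q'|]//= pq' mp; exact: leq_trans pq'. Qed.

(** Let f_la be the product of a monomial of degree r with a bump of radius 1 / la at
    h(y0), so that rho f_la is O(la ^ (l - r)). If la is about 1 / |h(y) - h(y0)|,
    then T f_la vanishes near y, and integrating its derivative of order l - r <= q
    from y to y0 gives T f_la (y0) = o(la ^ (l - r) |y - y0| ^ (l - r)). But
    T f_la (y0) does not depend on la, whence |h(y) - h(y0)| = o(|y - y0|). *)
Lemma support_point_derivative y0 e : 0 < e ->
  \forall y \near y0, `|val (h y) - val (h y0)| <= e * `|val y - val y0|.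
Proof.
move=> e0.
have [r [S [rl PS]]] : exists r, exists S : Sym r G E, (r <= l)%N /\ Phi y0 S != 0.
  have [f /eqP Tf] := ntT y0; apply: contrapT => nPhi; apply: Tf.
  rewrite representation big1// => k _; apply/eqP; apply: contrapT => /negP Pk.
  by apply: nPhi; exists k, (Dn k f (h y0)); split=> //; rewrite -ltnS.
pose x0 := h y0; pose m := (l - r)%N; pose P := Cp_monomial x0 S.
pose c := `|Phi y0 S|; have c0 : 0 < c by rewrite normr_gt0.
have mp : in_N p m by apply: in_N_le lp _; exact: leq_subr.
have mq := q_of_p mp.
have [M M0 cutM] := cutoff_exists Xo bump lp.
pose B := 2 ^+ l * (M * `|S|); have B0 : 0 <= B by rewrite !mulr_ge0 ?exprn_ge0.
have em0 : 0 < e ^+ m by rewrite exprn_gt0.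
pose D := 2 * B * 2 ^+ m; have D0 : 0 <= D by rewrite !mulr_ge0 ?exprn_ge0.
have D1 : 0 < D + 1 by rewrite ltr_wpDl.
pose e' := c * e ^+ m / (D + 1).
have e'0 : 0 < e' by rewrite divr_gt0// mulr_gt0.
have [r0 r00 r0Y] := open_ball_sub Yo y0.
have [r1 r10 eq1] := (near_subtypeP _ _).1 (equiT y0 mq e'0).
pose r2 := Num.min r0 r1; have r20 : 0 < r2 by rewrite lt_min r00.
have near2 : \forall y \near y0, `|val (h y) - val x0| <= 2.
  by apply: filterS (support_point_continuous (@hs y0) (ltr0n R 2)) => y; apply; exact: hs.
have near1 : \forall y \near y0, `|val (y : Y) - val y0| < r2 by exact: near_val_lt.
apply: filterS2 near1 near2 => y yr.
rewrite -/x0; set t := `|_| => t2.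
rewrite leNgt; apply/negP => ety.
have t0 : 0 < t by apply: le_lt_trans ety; rewrite mulr_ge0// ltW.
pose la := 2 / t; have la1 : 1 <= la by rewrite ler_pdivlMr// mul1r.
have la0 : 0 < la by exact: lt_le_trans la1.
have [phi [pp phi1 phi0 phiM]] := cutM x0 _ la0.
pose g := cut Xo pp P.
have Tgy0 : T g y0 = Phi y0 S.
  rewrite -[RHS]/(T P y0); apply: (support_point_cut (x := x0)); first exact: hs.
  have la20 : 0 < la^-1 / 2 by rewrite divr_gt0// invr_gt0.
  by apply: filterS (near_val_lt _ la20) => z zx; apply: phi1; exact: ltW.
have rhog : rho K l g <= B * la ^+ m.
  have a0 : 0 <= `|S| * la^-1 ^+ r by rewrite mulr_ge0 ?exprn_ge0 ?invr_ge0 ?(ltW la0).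
  have Pb k z : (k <= l)%N -> `|val z - val x0| <= la^-1 ->
      `|Dn k P z| <= `|S| * la^-1 ^+ r * la ^+ k.
    move=> kl zx; rewrite Dn_Cp_monomial ?(in_N_le lp)//.
    have [kr|rk] := leqP k r; last first.
      by rewrite monomial_jet_gt// normr0 mulr_ge0 ?exprn_ge0// ltW.
    apply: le_trans (norm_monomial_jet _ _ kr) _; rewrite -mulrA ler_wpM2l//.
    have -> : la^-1 ^+ r * la ^+ k = la^-1 ^+ (r - k).
      rewrite -[in LHS](subnK kr) exprD -mulrA -exprMn mulVf ?gt_eqF//.
      by rewrite expr1n mulr1.
    by rewrite lerXn2r// nnegrE// invr_ge0 ltW.
  have := @rho_cut _ _ _ X p Xo K l M _ la x0 phi pp P lp M0 a0 la1 phi0 phiM Pb.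
  (* this is where the degree r of the monomial gains over the l derivatives *)
  have laE : la^-1 ^+ r * la ^+ l = la ^+ m.
    by rewrite -{1}(subnK rl) exprD mulrCA -exprMn mulVf ?gt_eqF// expr1n mulr1.
  by rewrite -laE /B; congr (_ <= _); ring.
have lat : la^-1 < t by rewrite /la invf_div ltr_pdivrMr// ltr_pMr// ltr1n.
have Tgy : \forall z \near (y : Y), T g z = 0.
  (* the bump at h(y0) has radius t / 2, where t is the distance from h(y0) to h(y) *)
  have tl0 : 0 < (t - la^-1) / 2 by rewrite divr_gt0// subr_gt0.
  apply: filterS (support_point_continuous (@hs y) tl0) => z /(_ _ (@hs z)) hz.
  apply: (@hs z); apply: cut_far phi0 _.
  have := ler_distD (val (h z)) (val (h y)) (val x0); rewrite -/t.
  rewrite (distrC (val (h y))) => hh; move: lat hz hh; lra.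
have DTgy j : Dn j (T g) y = 0 by rewrite (Dn_near Yo j (g := 0)) ?Dn_cst0.
have yr1 z : `|val z - val y0| < r2 -> `|val z - val y0| < r1.
  by move=> zr; apply: lt_le_trans zr _; rewrite ge_min lexx orbT.
pose s := e' * (B * la ^+ m).
have near_s z : `|val z - val y0| < r2 -> `|Dn m (T g) z - Dn m (T g) y0| <= s.
  by move=> /yr1/eq1/(_ g)/le_trans; apply; rewrite ler_wpM2l ?(ltW e'0).
have Dm z : `|val z - val y0| < r2 -> `|Dn m (T g) z| <= 2 * s.
  move=> zr; have := near_s y yr; rewrite DTgy sub0r normrN => sy0.
  rewrite -[Dn m (T g) z](subrK (Dn m (T g) y0)) mulr_natl mulr2n.
  by apply: le_trans (ler_normD _ _) _; apply: lerD => //; exact: near_s.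
have := @Dn_flat_bound _ _ _ _ Yo q (T g) m (2 * s) (val y0) r2 y (Cp_is _) mq
  _ yr (fun j _ => DTgy j) Dm m 0%N y0 (addn0 m).
rewrite subrr normr0 -norm_Ty Tgy0 => /(_ _ r20) cs.
have {}cs : c <= 2 * s * `|val y0 - val y| ^+ m.
  apply: cs => z zr; apply: r0Y; apply: lt_le_trans zr _.
  by rewrite ge_min lexx.
have yt : `|val y0 - val y| <= t / e by rewrite distrC ler_pdivlMr// mulrC ltW.
(* contradiction: e' was chosen so that the bound on c falls below c *)
have : c <= c * (D / (D + 1)).
  apply: le_trans cs _; apply: le_trans (_ : 2 * s * (t / e) ^+ m <= _).
    apply: ler_wpM2l.
      apply: mulr_ge0 => //; apply: mulr_ge0; first exact: ltW.
      by apply: mulr_ge0 => //; apply: exprn_ge0; exact: ltW.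
    have te0 : 0 <= t / e by rewrite divr_ge0 ?(ltW t0) ?(ltW e0).
    by apply: lerXn2r => //; rewrite nnegrE.
  rewrite le_eqVlt; apply/orP; left; apply/eqP.
  rewrite /s /e' /D /la !exprMn !exprVn; field.
  by rewrite !expf_neq0 ?gt_eqF.
rewrite leNgt => /negP; apply.
by rewrite gtr_pMr// ltr_pdivrMr// mul1r ltrDl.
Qed.

(** The derivative of h vanishes, so h is constant on balls. *)
Lemma support_point_locally_constant y0 : \forall y \near y0, h y = h y0.
Proof.
have [r r0 rY] := open_ball_sub Yo y0.
apply: filterS (near_val_lt y0 r0) => y yr; apply: val_inj.
apply/eqP; rewrite -subr_eq0 -normr_le0 -(mul0r `|val y - val y0|).
have y0r : `|val y0 - val y0| < r by rewrite subrr normr0.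
apply: (@mean_value_segment _ _ _ _ (fun y => val (h y))) => [t t01|z t t01 zt e e0].
  by apply: rY; exact: segment_ball.
by rewrite add0r; exact: support_point_derivative.
Qed.


Let Phi_near k y0 (S : Sym k G E) :
  \forall y \near y0, Phi y S = T (Cp_monomial (h y0) S) y.
Proof. by apply: filterS (support_point_locally_constant y0) => y; rewrite /Phi => ->. Qed.

Let DPhiE m k y (S : Sym k G E) :
  DPhi m (@Phi k) y S = Dn m (T (Cp_monomial (h y) S)) y.
Proof. exact: (Dn_near Yo m (Phi_near y S)). Qed.

Let Phi_bounded k y m : (k <= l)%N -> in_N q m ->
  bounded_linear_operator (DPhi m (@Phi k) y).
Proof.
move=> kl mq; split=> [a S S'|].
  by rewrite !DPhiE Cp_monomial_lin linT DnP.
have [C C0 CT] := boundT y mq; have [D D0 rhoP] := rho_Cp_monomial (h y).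
exists (C * D) => S; rewrite DPhiE; apply: le_trans (CT _) _.
by rewrite -mulrA ler_wpM2l// rhoP.
Qed.

(** As h is locally constant, D_y^m Phi_k(y, S) is D^m T P_S (y) for a monomial P_S which is
    fixed near y and depends linearly on S, with rho K l P_S = O(|S|). *)
Lemma Phi_admissible k : (k <= l)%N ->
  (exists2 e, 0 < e & forall m y, in_N q m ->
    precompact [set Dn m (T f) y | f in [set f : Cp X E p | rho K l f < e]]) ->
  admissible q (@Phi k).
Proof.
move=> kl [e e0 pcT]; split=> [y|S|y m mq|m mq].
- split; first exact: Phi_linear.
  have [_ [M PM]] := Phi_bounded y kl q0; exists M => S; apply: le_trans (PM S).
  by rewrite DPhiE /Phi norm_Ty.
- apply: is_Cp_near => // y; exists (T (Cp_monomial (h y) S) : Y -> F).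
    exact: Cp_is.
  exact: Phi_near.
- split; first by have [] := Phi_bounded y kl mq.
  have [D D0 rhoP] := rho_Cp_monomial (h y).
  have D1 : 0 < D + 1 by rewrite ltr_wpDl.
  have d0 : 0 < e / (D + 1) by rewrite divr_gt0.
  exists (ball (0 : Sym k G E) (e / (D + 1))); split.
  + exact: ball_open.
  + by exists 0; exact: ballxx.
  apply: precompact_subset (pcT m y mq) => _ [S Sd <-].
  exists (Cp_monomial (h y) S); last by rewrite DPhiE.
  move: Sd; rewrite -ball_normE /= sub0r normrN => Sd.
  apply: le_lt_trans (rhoP _ S kl) _.
  apply: le_lt_trans (_ : (D + 1) * `|S| < e); first by rewrite ler_wpM2r// lerDl.
  by rewrite mulrC -ltr_pdivlMr.
- split=> [y|y]; first exact: Phi_bounded.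
  apply/(@cvgrPdist_le _ _ _ (nbhs y)) => d d0.
  have [D D0 rhoP] := rho_Cp_monomial (h y).
  have D1 : 0 < D + 1 by rewrite ltr_wpDl.
  have dD : 0 < d / (D + 1) by rewrite divr_gt0.
  apply: filterS2 (support_point_locally_constant y) (equiT y mq dD) => z hz Tz.
  rewrite sub0r normrN ger0_norm; last first.
    have [bz by_] := (Phi_bounded z kl mq, Phi_bounded y kl mq).
    by apply: le_trans (operator_norm_ge (v := 0) bz by_ _) => //; rewrite normr0.
  apply: ge_sup; first by eexists; exists 0 => //=; rewrite normr0.
  move=> _ [S S1 <-]; rewrite !fctE !DPhiE hz; apply: le_trans (Tz _) _.
  apply: le_trans (_ : d / (D + 1) * (D + 1) <= _); last by rewrite divfK// gt_eqF.
  rewrite ler_wpM2l ?(ltW dD)//; apply: le_trans (rhoP _ S kl) _.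
  by rewrite ler_wpDr// ler_piMr.
Qed.

Lemma subtype_hausdorff : hausdorff_space X.
Proof.
move=> x x' xx'; apply: contrapT => nxx'.
have d0 : 0 < `|val x - val x'| / 2.
  by rewrite divr_gt0// normr_gt0 subr_eq0; apply/eqP => /val_inj.
have [z [/= zx zx']] := xx' _ _ (near_val_lt x d0) (near_val_lt x' d0).
have := ler_distD (val z) (val x) (val x').
rewrite (distrC (val x) (val z)) => h1; move: zx zx' h1; lra.
Qed.

Lemma representable_of_estimates :
  (exists2 e, 0 < e & forall m y, in_N q m ->
    precompact [set Dn m (T f) y | f in [set f : Cp X E p | rho K l f < e]]) ->
  representable q (fun f => T f : Y -> F).
Proof.
move=> pcT; exists l, (fun k y S => @Phi k y S), (range h : set X),
  (fun i => val i), (fun i => [set y | h y = val i]); split=> //.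
- exists K; first by move=> _ [i _ <-]; have [y _ <-] := set_valP i; exact: hK.
  by split=> //; apply: compact_closed => //; exact: subtype_hausdorff.
- split; first split.
  + apply/seteqP; split=> // y _.
    by exists (Sub (h y) (mem_set (imageT h y))).
  + move=> i j _ _ [y [/= hi hj]]; apply: val_inj; exact: etrans (esym hi) hj.
  + by move=> i _; have [y _ hy] := set_valP i; exists y.
  move=> i; split.
    rewrite openE => y /= hy; apply: filterS (support_point_locally_constant y).
    by move=> z /= ->.
  rewrite -openC openE => y /= hy; apply: filterS (support_point_locally_constant y).
  by move=> z /= ->.
- by move=> f i y /= <-; exact: representation.
- by move=> k kl; exact: Phi_admissible.
Qed.

End Necessity.

Theorem theorem26 (R : realType) (G H E F : completeNormedModType R)
    (X : set G) (Y : set H) (p q : smooth_order) :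
  open X -> open Y ->
  has_bump G p ->
  le_order (Some 1%N) p -> le_order p q ->
  (forall T : Cp X E p -> Cp Y F q,
     compact_operator T -> separating T -> nowhere_trivial T ->
     representable q (fun f => T f : Y -> F)) /\
  (forall T : Cp X E p -> Y -> F,
     representable q T ->
     exists T' : Cp X E p -> Cp Y F q,
       [/\ forall f, (T' f : Y -> F) = T f,
           compact_operator T' & separating T']).
Proof.
move=> Xo Yo bump _ pq; split=> [T cT sepT ntT|T]; last first.
  exact: representable_compact.
have [K [l [cK lp boundT equiT pcT]]] := compact_operator_estimates cT.
have [linT _] := cT.
refine (representable_of_estimates Xo Yo bump linT sepT ntT cK lp boundT equiT pq pcT).
Qed.
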